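(* Let $g^t\in\mathcal T(q,p,\epsilon)$, $0\le t\le1$, be a full one-parameter family, with spin semigroup $\Gamma_0\equiv\Gamma_g$. Let $\chi_n:\Gamma_n\to\Gamma_{n-1}$, $n=1,2,\dots$, be any sequence of admissible homomorphisms. Then there is a map $g=g^t$ in the family which admits a sequence of return maps of types $\chi_n$; that is, there are maps $h_0=g,h_1,h_2,\dots$ of class $\mathcal T$ such that for each $n\ge1$, $h_n$ is a return map of $h_{n-1}$ to its central interval and the type of this return map is $\chi_n$.
   Context: All intervals are closed. Class $\mathcal T$: let $I_k$, $-q\le k\le p$ ($p,q\in\mathbb N$), be finitely many disjoint intervals compactly contained in a base interval $J$, numbered in the order of the line, $I_0$ being marked as central. A map $g:\bigcup I_k\to J$ is in $\mathcal T$ if it is continuous, has a single turning point $c\in I_0$, $g(\partial I_k)\subset\partial J$ for all $k$, and $g$ has no non-trivial wandering intervals (intervals with pairwise disjoint iterates, all defined, not converging to a periodic orbit). Spin semigroups: $\Gamma=\langle I_{-q},\dots,I_0,\dots,I_p\rangle$ is a free semigroup on linearly ordered generators with marked generator $I_0$ and with a multiplicative function (spin) $\epsilon:\Gamma\to\{\pm1\}$. It is positively (negatively) oriented if $\epsilon(I_0)=+1$ ($-1$). $W(\Gamma)$ is the set of words $\gamma=I_{k(0)}\cdots I_{k(s)}$ whose last letter is $I_0$ while all other letters differ from $I_0$. $W(\Gamma)$ is ordered lexicographically via the integer vectors with components $\epsilon(\gamma_{t-1})k(t)$, $t=0,\dots,s$, where $\gamma_{t}=I_{k(0)}\cdots I_{k(t)}$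 and $\epsilon(\gamma_{-1})=1$. Let $\Gamma'$ be another such semigroup with generators $I'_{-q'},\dots,I'_{p'}$ and spin $\epsilon'$. A homomorphism $\chi:\Gamma'\to\Gamma$ is unimodal if $\chi(I'_k)\in W(\Gamma)$ for all $k$ and $k\mapsto\chi(I'_k)$ is strictly monotone on $\{-q',\dots,0\}$ and on $\{0,\dots,p'\}$ with an extremum at $0$, which is a minimum if $\Gamma$ is positively oriented and a maximum if it is negatively oriented. It is admissible if additionally $\epsilon'(I'_j)=\operatorname{sgn}(j)\,\epsilon(\chi(I'_j))$ for all $j$, with the convention $\operatorname{sgn}(0)=+1$. For $g\in\mathcal T$, $\Gamma_g$ is generated by the intervals $I_k$ with spin: for $k\ne0$, $\epsilon_g(I_k)=\pm1$ according to whether $g|I_k$ preserves/reverses orientation; $\epsilon_g(I_0)=+1$ ($-1$) if $c$ is a minimum (maximum) of $g|I_0$. $\mathcal T(q,p,\epsilon)$ is the subclass of $\mathcal T$ with given $q,p$ and spin $\epsilon$. Return maps: suppose $c$ returns to $I_0$. Let $K_0\ni c$ be the pull-back of $I_0$ along the first return of $c$ to $I_0$, and let $K_j\subset I_0$, $-n\le j\le m$, $j\ne0$, be finitely many other pull-backs of $I_0$ corresponding to first returns of some points of $I_0$ to $I_0$, pairwise disjoint, numbered in the order of the line (the pull-back of $I_0$ along an orbit $x,\dots,g^{\circ s}x\in\operatorname{int}I_0$ is the interval $S_0\ni x$ with $S_s=I_0$ and $S_i$ the maximal interval containing $g^{\circ i}x$ with $g(S_i)\subset S_{i+1}$). The first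 return map $h:\bigcup K_j\to I_0$ is called a return map of $g$. Its type is the homomorphism $\chi:\Gamma_h\to\Gamma_g$ with $\chi(K_j)=I_{k(1)}\cdots I_{k(s-1)}I_0$, where $g^{\circ i}K_j\subset I_{k(i)}$, $k(i)\neq0$ for $1\le i\le s-1$, and $g^{\circ s}K_j\subset I_0$ is the first return. Families: $g^t\in\mathcal T(q,p,\epsilon)$, $t_0\le t\le t_1$, is a continuous one-parameter family if the intervals $I_k(t)$ (and base interval) move continuously and each branch $g^t|I_k(t)\circ\psi^t_k$ ($\psi_k^t:[0,1]\to I_k(t)$ the orientation preserving affine rescaling) depends continuously on $t$ in the $C^0$ topology. It is full if $g^{t_0}I_0(t_0)$ covers all intervals $I_k(t_0)$ while $g^{t_1}I_0(t_1)$ does not intersect the interiors of the $I_k(t_1)$, or vice versa. *)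

(* Defs.v *)
From HB Require Import structures.
From mathcomp Require Export all_boot all_order all_algebra.
From mathcomp Require Export all_classical all_reals all_analysis.
Export Order.TTheory GRing.Theory Num.Theory.
Export numFieldNormedType.Exports.

Set Implicit Arguments.
Unset Strict Implicit.
Unset Printing Implicit Defensive.

Local Open Scope classical_set_scope.
Local Open Scope ring_scope.

(** * Spin semigroups *)

(* The generator I_k is represented by the integer k, with -q <= k <= p. *)
Definition in_range (q p : nat) (k : int) : bool := - q%:Z <= k <= p%:Z.

(* Elements of the free semigroup on the generators: nonempty words. *)
Definition is_word (q p : nat) (w : seq int) : bool :=
  (w != [::]) && all (in_range q p) w.

Record spin_semigroup := SpinSemigroup {
  sneg : nat;
  spos : nat;
  spin : seq int -> int;
  spin_sign : forall w, is_word sneg spos w -> spin w = 1 \/ spin w = -1;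
  spin_cat : forall v w, is_word sneg spos v -> is_word sneg spos w ->
    spin (v ++ w) = spin v * spin w
}.

Definition generator (G : spin_semigroup) (k : int) : bool :=
  in_range (sneg G) (spos G) k.

Definition in_semigroup (G : spin_semigroup) (w : seq int) : bool :=
  is_word (sneg G) (spos G) w.

Definition positively_oriented (G : spin_semigroup) : Prop :=
  spin G [:: 0] = 1.

Definition negatively_oriented (G : spin_semigroup) : Prop :=
  spin G [:: 0] = -1.

(* The set W(G). *)
Definition in_W (G : spin_semigroup) (w : seq int) : Prop :=
  exists v : seq int,
    [/\ w = rcons v 0, all (generator G) v & all (fun k => k != 0) v].

(* [take t w] is the prefix gamma_{t-1}; its spin is 1 by convention if t = 0. *)
Definition lex_vector (G : spin_semigroup) (w : seq int) : seq int :=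
  [seq (if t == 0%N then 1 else spin G (take t w)) * nth 0 w t
     | t <- iota 0 (size w)].

(* No vector of an element of W(G) is a proper prefix of another one, so the
   way [seqlexi] compares vectors of different lengths is immaterial. *)
Definition W_lt (G : spin_semigroup) (v w : seq int) : bool :=
  (lex_vector G v < lex_vector G w :> seqlexi int)%O.

Definition W_le (G : spin_semigroup) (v w : seq int) : bool :=
  (lex_vector G v <= lex_vector G w :> seqlexi int)%O.

Definition semigroup_hom (G' G : spin_semigroup)
    (chi : seq int -> seq int) : Prop :=
  (forall w, in_semigroup G' w -> in_semigroup G (chi w)) /\
  (forall v w, in_semigroup G' v -> in_semigroup G' w ->
     chi (v ++ w) = chi v ++ chi w).

Definition strictly_monotone_gen (G : spin_semigroup)
    (chi : seq int -> seq int) (a b : int) : Prop :=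
  (forall i j : int, a <= i -> i < j -> j <= b -> W_lt G (chi [:: i]) (chi [:: j])) \/
  (forall i j : int, a <= i -> i < j -> j <= b -> W_lt G (chi [:: j]) (chi [:: i])).

Definition unimodal (G' G : spin_semigroup) (chi : seq int -> seq int) : Prop :=
  [/\ semigroup_hom G' G chi,
      forall k, generator G' k -> in_W G (chi [:: k]),
      strictly_monotone_gen G chi (- (sneg G')%:Z) 0,
      strictly_monotone_gen G chi 0 (spos G')%:Z &
      (positively_oriented G -> forall k, generator G' k ->
         W_le G (chi [:: 0]) (chi [:: k])) /\
      (negatively_oriented G -> forall k, generator G' k ->
         W_le G (chi [:: k]) (chi [:: 0]))].

Definition sgn1 (j : int) : int := if j < 0 then -1 else 1.

Definition admissible (G' G : spin_semigroup)
    (chi : seq int -> seq int) : Prop :=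
  unimodal G' G chi /\
  forall j, generator G' j -> spin G' [:: j] = sgn1 j * spin G (chi [:: j]).

(** * The class T *)

(* A map defined on the union of the intervals I_k = [lo k, hi k],
   -nneg <= k <= npos, of the base interval J = [base_lo, base_hi], with marked
   turning point [crit]. The values of
   [lo] and [hi] at other indices and of [fn] at other points are irrelevant. *)
Record interval_map (R : realType) := IntervalMap {
  base_lo : R;
  base_hi : R;
  nneg : nat;
  npos : nat;
  lo : int -> R;
  hi : int -> R;
  fn : R -> R;
  crit : R
}.

Section ClassT.
Variable R : realType.
Implicit Types g h : interval_map R.

Definition base_itv g : set R := `[base_lo g, base_hi g].

Definition is_index g (k : int) : bool := in_range (nneg g) (npos g) k.

Definition itv g (k : int) : set R := `[lo g k, hi g k].

Definition itv_interior g (k : int) : set R := `]lo g k, hi g k[.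

Definition dom g : set R := [set x | exists2 k, is_index g k & itv g k x].

Definition turning_point g (x : R) : Prop :=
  (exists2 k, is_index g k & itv_interior g k x) /\
  ((\forall y \near x, fn g x <= fn g y) \/
   (\forall y \near x, fn g y <= fn g x)).

Definition converges_to_periodic_orbit g (L : set R) : Prop :=
  exists (z : R) (N : nat),
    [/\ (0 < N)%N,
        forall i, (i < N)%N -> dom g (iter i (fn g) z),
        iter N (fn g) z = z &
        forall e : R, 0 < e -> \forall n \near \oo, forall x, L x ->
          exists2 i, (i < N)%N & `|iter n (fn g) x - iter i (fn g) z| < e].

Definition wandering_interval g (L : set R) : Prop :=
  [/\ exists u v : R, u < v /\ L = `[u, v]%classic,
      forall (n : nat) x, L x -> dom g (iter n (fn g) x),
      forall m n : nat, m <> n ->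
        (iter m (fn g) @` L) `&` (iter n (fn g) @` L) = set0 &
      ~ converges_to_periodic_orbit g L].

(* Disjoint nondegenerate closed intervals, numbered in the order of the line. *)
Definition ordered_intervals g : Prop :=
  (forall k, is_index g k -> lo g k < hi g k) /\
  (forall i j, is_index g i -> is_index g j -> i < j -> hi g i < lo g j).

Definition class_T g : Prop :=
  [/\ ordered_intervals g,
      forall k, is_index g k -> base_lo g < lo g k /\ hi g k < base_hi g,
      (forall x, dom g x -> base_itv g (fn g x)) /\
        {within dom g, continuous (fn g)},
      itv g 0 (crit g) /\ (forall x, turning_point g x <-> x = crit g) &
      (forall k, is_index g k ->
         [set fn g (lo g k); fn g (hi g k)] `<=`
         [set base_lo g; base_hi g]) /\
        ~ (exists L, wandering_interval g L)].

Definition preserves_orientation g (k : int) : Prop :=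
  forall x y, itv g k x -> itv g k y -> x < y -> fn g x < fn g y.

Definition reverses_orientation g (k : int) : Prop :=
  forall x y, itv g k x -> itv g k y -> x < y -> fn g y < fn g x.

(* [G] is the spin semigroup of [g]; it suffices to prescribe the spin on the
   generators. *)
Definition spin_semigroup_of g (G : spin_semigroup) : Prop :=
  [/\ nneg g = sneg G,
      npos g = spos G,
      forall k, is_index g k -> k <> 0 ->
        (spin G [:: k] = 1 /\ preserves_orientation g k) \/
        (spin G [:: k] = -1 /\ reverses_orientation g k) &
      (spin G [:: 0] = 1 /\ forall x, itv g 0 x -> fn g (crit g) <= fn g x) \/
      (spin G [:: 0] = -1 /\ forall x, itv g 0 x -> fn g x <= fn g (crit g))].

(* The class T(q, p, epsilon), for the data (q, p, epsilon) carried by [G]. *)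
Definition class_T_spin (G : spin_semigroup) g : Prop :=
  class_T g /\ spin_semigroup_of g G.

(** * Return maps *)

Definition first_return g (x : R) (s : nat) : Prop :=
  [/\ itv g 0 x,
      (0 < s)%N,
      forall i, (i < s)%N -> dom g (iter i (fn g) x),
      forall i, (0 < i < s)%N -> ~ itv g 0 (iter i (fn g) x) &
      itv g 0 (iter s (fn g) x)].

Definition maximal_interval (A E : set R) (x : R) : Prop :=
  [/\ is_interval A, A x, A `<=` E &
      forall B, is_interval B -> B `<=` E -> A `<=` B -> B = A].

(* [K] is the pull-back of I_0 along the orbit x, ..., g^s(x). *)
Definition pull_back g (x : R) (s : nat) (K : set R) : Prop :=
  itv_interior g 0 (iter s (fn g) x) /\
  exists S : nat -> set R,
    [/\ S 0%N = K, S s = itv g 0 &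
        forall i, (i < s)%N ->
          maximal_interval (S i) [set y | dom g y /\ S i.+1 (fn g y)]
            (iter i (fn g) x)].

Definition return_map g h : Prop :=
  [/\ base_lo h = lo g 0,
      base_hi h = hi g 0,
      ordered_intervals h &
      forall j, is_index h j -> exists (x : R) (s : nat),
        [/\ j = 0 -> x = crit g,
            first_return g x s,
            pull_back g x s (itv h j) &
            forall y, itv h j y ->
              first_return g y s /\ fn h y = iter s (fn g) y]].

(* [chi] is the type of the return map [h] of [g]. The word [chi [:: j]] lists
   the intervals I_k visited by K_j at the times 1, ..., s, where s is the
   first return time; membership in W(G) says that only the last one is I_0. *)
Definition return_type g h (G' G : spin_semigroup)
    (chi : seq int -> seq int) : Prop :=
  [/\ spin_semigroup_of g G,
      spin_semigroup_of h G',
      semigroup_hom G' G chi &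
      forall j, is_index h j ->
        in_W G (chi [:: j]) /\
        forall i, (i < size (chi [:: j]))%N ->
          iter i.+1 (fn g) @` itv h j `<=` itv g (nth 0 (chi [:: j]) i)].

End ClassT.

(** * One-parameter families *)

Section Families.
Variable R : realType.

(* The branch g|I_k composed with the affine map [0, 1] -> I_k. *)
Definition branch (g : interval_map R) (k : int) (u : R) : R :=
  fn g (line_path (lo g k) (hi g k) u).

Definition continuous_family (G : spin_semigroup) (t0 t1 : R)
    (g : R -> interval_map R) : Prop :=
  [/\ forall t, t0 <= t <= t1 -> class_T_spin G (g t),
      {within `[t0, t1], continuous (fun t => base_lo (g t))} /\
      {within `[t0, t1], continuous (fun t => base_hi (g t))},
      forall k, generator G k ->
        {within `[t0, t1], continuous (fun t => lo (g t) k)} /\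
        {within `[t0, t1], continuous (fun t => hi (g t) k)} &
      forall k t, generator G k -> t0 <= t <= t1 ->
        {uniform `[0, 1],
          (fun s => branch (g s) k) @ within `[t0, t1] (nbhs t)
          --> branch (g t) k}].

Definition covers_all (g : interval_map R) : Prop :=
  forall k, is_index g k -> itv g k `<=` fn g @` itv g 0.

Definition misses_all (g : interval_map R) : Prop :=
  forall k, is_index g k -> (fn g @` itv g 0) `&` itv_interior g k = set0.

Definition full_family (G : spin_semigroup) (t0 t1 : R)
    (g : R -> interval_map R) : Prop :=
  continuous_family G t0 t1 g /\
  ((covers_all (g t0) /\ misses_all (g t1)) \/
   (misses_all (g t0) /\ covers_all (g t1))).

End Families.

(* Main.v *)
(** Renormalization by nested parameter intervals. Suppose that along a parameter
    interval the critical value of g^t crosses all the intervals I_k(t). In W(Gamma)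
    the lexicographic order is the order of the pull-backs of I_0 on the line, so
    a unimodal chi prescribes, as soon as the critical value lies in the pull-back
    along chi(I_0), disjoint intervals K_j numbered in the right order in the two
    halves of I_0, on which the first return map has type chi; admissibility
    says that it has the right spin. While the critical value of g^t crosses the
    pull-back along chi(I_0), the critical value of the return map crosses I_0.
    Restricting to a subinterval of parameters at whose ends it lies just beyond
    all the K_j reproduces the initial situation for the family of return maps.
    Iterating gives nested parameter intervals, and a common point of them is the
    required parameter. *)

Require Import Defs.
From mathcomp Require Import ring lra zify.

Set Implicit Arguments.
Unset Strict Implicit.
Unset Printing Implicit Defensive.

Local Open Scope classical_set_scope.
Local Open Scope ring_scope.

(** * Signed monotone functions *)

Section RealLine.
Variable R : realType.
Implicit Types (f : R -> R) (a b e x y : R) (D : set R).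

(** The induction hypothesis is [crossing_family]. It fixes the side of the critical value at the
    two ends of the parameter interval, and replaces uniform convergence of rescaled branches by
    joint continuity in the original coordinates, which survives composition and restriction to
    moving subintervals.

    The obstacle is the choice of the parameter subinterval. The K_j exist only once the critical
    value lies in the pull-back along chi(I_0), and at the very ends of that pull-back the critical
    value of the return map would be an end of I_0, so that K_0 would not be a pull-back at an
    interior point. The new parameter ends must thus be chosen before the K_j are known, and
    strictly inside. This is the purpose of [barrier]: a value computed from g^t alone, beyond the
    critical value and all the I_k, whose two preimages in the interior of I_0 move continuously for
    every t and enclose whatever K_j appear later.

    Class T also excludes wandering intervals; each single return map inherits this, without regard
    to parameters. Factors equal to 1 or -1 treat both orientations at once. *)

Definition is_sign e := e = 1 \/ e = -1.

Definition smono e f a b :=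
  forall x y, a <= x -> x < y -> y <= b -> e * f x < e * f y.

Definition cont_on D f :=
  forall x, D x -> forall e, 0 < e -> \forall y \near x, D y -> `|f y - f x| < e.

Lemma cont_onP D f : {within D, continuous f} <-> cont_on D f.
Proof.
split=> [/subspace_continuousP h x Dx e e0|h].
  move: (h x Dx) => /cvgrPdist_lt/(_ e e0); rewrite near_withinE.
  by apply: filterS => y H Dy; rewrite distrC; exact: H.
apply/subspace_continuousP => x Dx; apply/cvgrPdist_lt => e e0.
rewrite near_withinE; apply: filterS (h x Dx e e0) => y H Dy.
by rewrite distrC; exact: H.
Qed.

Lemma cont_onW D D' f : D `<=` D' -> cont_on D' f -> cont_on D f.
Proof.
move=> DD' h x Dx e e0; apply: filterS (h x (DD' _ Dx) e e0) => y H Dy.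
exact/H/DD'.
Qed.

Lemma near_itvoo a b x : a < x -> x < b -> \forall y \near x, a < y < b.
Proof.
move=> ax xb; near=> y; apply/andP; split; near: y; [exact: lt_nbhsr|exact: lt_nbhsl].
Unshelve. all: by end_near. Qed.

Lemma near_dist x e : 0 < e -> \forall y \near x, `|y - x| < e.
Proof.
move=> e0; have : \forall y \near x, x - e < y < x + e by apply: near_itvoo; lra.
by apply: filterS => y; rewrite ltr_distl.
Qed.

Lemma near_dist_ex x (P : R -> Prop) :
  (\forall y \near x, P y) -> exists2 d, 0 < d & forall y, `|y - x| < d -> P y.
Proof.
move=> /nbhs_ballP [d /= d0 H]; exists d => // y yx; apply: H.
by rewrite -ball_normE /= distrC.
Qed.

Lemma smono_lt e f a b x y : smono e f a b -> a <= x <= b -> a <= y <= b ->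
  (e * f x < e * f y) = (x < y).
Proof.
move=> h /andP[ax xb] /andP[ay yb].
case: (ltgtP x y) => [xy|xy|->]; last by rewrite ltxx.
- exact: h.
- by apply/negbTE; rewrite -leNgt; apply/ltW/h.
Qed.

Lemma smono_le e f a b x y : smono e f a b -> a <= x <= b -> a <= y <= b ->
  (e * f x <= e * f y) = (x <= y).
Proof. by move=> h hx hy; rewrite !leNgt (smono_lt h). Qed.

Lemma smono_inj e f a b x y : smono e f a b -> a <= x <= b -> a <= y <= b ->
  f x = f y -> x = y.
Proof.
move=> h hx hy fxy; apply/eqP.
by rewrite eq_le -(smono_le h hx hy) -(smono_le h hy hx) fxy lexx.
Qed.

Lemma smono_not_extremum e f a b x : is_sign e -> smono e f a b ->
  a < x < b ->
  ~ ((\forall y \near x, f x <= f y) \/ (\forall y \near x, f y <= f x)).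
Proof.
move=> se h axb H.
have N : \forall y \near x, a < y < b by apply: near_itvoo; lra.
case: H => H; have [d d0 {}H] := near_dist_ex (filterI H N);
  have dd : 0 < d / 2 by [lra];
  have [H1 /andP[? ?]] := H (x - d / 2) ltac:(rewrite ltr_norml; lra);
  have [H2 /andP[? ?]] := H (x + d / 2) ltac:(rewrite ltr_norml; lra);
  have := h (x - d / 2) x ltac:(lra) ltac:(lra) ltac:(lra);
  have := h x (x + d / 2) ltac:(lra) ltac:(lra) ltac:(lra);
  case: se => ->; lra.
Qed.

(** If two values agreed, the maximum and the minimum between the two points could be taken only at
    these points, so the function would be constant there and have an extremum at the midpoint.
    Hence it is injective, and a continuous injective function on an interval is monotone. *)
Lemma no_extremum_smono f a b : a < b -> cont_on `[a, b] f ->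
  (forall x, a < x < b ->
    ~ ((\forall y \near x, f x <= f y) \/ (\forall y \near x, f y <= f x))) ->
  exists2 e, is_sign e & smono e f a b.
Proof.
move=> ab cf noext.
have cf' : {within `[a, b], continuous f} by apply/cont_onP.
have inj_lt x y : a <= x -> x < y -> y <= b -> f x <> f y.
  move=> ax xy yb fxy.
  have cxy : {within `[x, y], continuous f}.
    apply/cont_onP; apply: cont_onW cf => z /=; rewrite !in_itv /=; lra.
  have [c] := EVT_max (ltW xy) cxy; rewrite in_itv /= => cxy' cmax.
  have [d] := EVT_min (ltW xy) cxy; rewrite in_itv /= => dxy' dmin.
  have nearxy z : x < z < y -> \forall t \near z, t \in `[x, y]%R.
    move=> /andP[xz zy]; apply: filterS (near_itvoo xz zy) => t.
    rewrite in_itv /=; lra.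
  have [cx|cx] := boolP (x < c < y).
    apply: (noext c); first lra.
    by right; apply: filterS (nearxy _ cx) => t; apply: cmax.
  have [dx|dx] := boolP (x < d < y).
    apply: (noext d); first lra.
    by left; apply: filterS (nearxy _ dx) => t; apply: dmin.
  have fc : f c = f x.
    have [->//|cx'] := eqVneq c x.
    suff -> : c = y by [].
    by apply/eqP; move: cx'; rewrite !eq_le; lra.
  have fd : f d = f x.
    have [->//|dx'] := eqVneq d x.
    suff -> : d = y by [].
    by apply/eqP; move: dx'; rewrite !eq_le; lra.
  have mxy : x < (x + y) / 2 < y by lra.
  apply: (noext _ (_ : a < (x + y) / 2 < b)); first lra.
  right; apply: filterS (nearxy _ mxy) => t txy.
  rewrite (le_trans (cmax _ txy)) // fc -fd; apply: dmin.
  by rewrite in_itv /=; lra.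
have inj : {in `[a, b]%R &, injective f}.
  move=> x y; rewrite !in_itv /= => hx hy fxy.
  case: (ltgtP x y) => // xy; last symmetry in fxy.
    by case: (inj_lt x y) => //; lra.
  by case: (inj_lt y x) => //; lra.
case: (itv_continuous_inj_mono cf' inj) => m; [exists 1|exists (-1)];
  try (by [left|right]); move=> x y ax xy yb.
  by rewrite !mul1r; apply: m => //; rewrite in_itv /=; lra.
by rewrite !mulN1r ltrN2; apply: m => //; rewrite in_itv /=; lra.
Qed.

(** An inverse obtained by choice, with default [a], so that it can be formed for any [f] and any
    parameter before a solution is known to exist. *)
Definition binv f a b y : R := xget a [set x | a <= x <= b /\ f x = y].

Lemma binvK e f a b x : smono e f a b -> a <= x <= b -> binv f a b (f x) = x.
Proof.
move=> h hx; rewrite /binv; case: xgetP => [y _ [hy fyx]|/(_ x)]; last by case.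
exact: smono_inj h hy hx fyx.
Qed.

Lemma binvP e f a b y : is_sign e -> cont_on `[a, b] f -> a <= b ->
  e * f a <= e * y <= e * f b -> a <= binv f a b y <= b /\ f (binv f a b y) = y.
Proof.
move=> se cf ab H.
suff [x hx] : exists x, a <= x <= b /\ f x = y.
  by rewrite /binv; case: xgetP => [z _ //|/(_ x)]; case.
have cf' : {within `[a, b], continuous f} by apply/cont_onP.
have [|c] := IVT (v := y) ab cf'; last by rewrite in_itv /=; exists c.
by rewrite ge_min le_max; case: se H => ->; lra.
Qed.

Lemma sign_mul e e' : is_sign e -> is_sign e' -> is_sign (e * e').
Proof.
by move=> [->|->] [->|->]; rewrite ?mul1r ?mulN1r ?opprK; [left|right|right|left].
Qed.

Lemma sign_sq e : is_sign e -> e * e = 1.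
Proof. by case=> ->; rewrite ?mulrNN mulr1. Qed.

Lemma smono_comp e e' f f' a b a' b' : is_sign e ->
  smono e f a b -> (forall x, a <= x <= b -> a' <= f x <= b') ->
  smono e' f' a' b' -> smono (e * e') (f' \o f) a b.
Proof.
move=> se m fab m' x y ax xy yb /=.
have hx : a <= x <= b by lra.
have hy : a <= y <= b by lra.
have := m x y ax xy yb; have := fab _ hx; have := fab _ hy.
case: se => -> hfx hfy; rewrite ?mul1r ?mulN1r => lt.
  by apply: m'; lra.
have lt' : f y < f x by lra.
have := m' (f y) (f x) ltac:(lra) lt' ltac:(lra); lra.
Qed.

Lemma cont_on_comp f f' a b a' b' : cont_on `[a, b] f ->
  (forall x, a <= x <= b -> a' <= f x <= b') ->
  cont_on `[a', b'] f' -> cont_on `[a, b] (f' \o f).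
Proof.
move=> cf fab cf' x /=; rewrite in_itv /= => hx e e0.
have /near_dist_ex [d d0 H] : \forall y \near f x, y \in `[a', b']%R -> `|f' y - f' (f x)| < e.
  by apply: cf' => //=; rewrite in_itv /= fab.
have hx' : [set` `[a, b]] x by rewrite /= in_itv.
apply: filterS (cf x hx' d d0) => y hy yab; apply: H; first exact: hy.
by rewrite in_itv /= fab.
Qed.

End RealLine.

(** * Curves in one-parameter families *)

Section Curves.
Variable R : realType.
Implicit Types (P : set R) (u v a b : R -> R) (f : R -> R -> R) (e x y : R).

Lemma near_lt_curve P u v t : cont_on P u -> cont_on P v -> P t -> u t < v t ->
  \forall r \near t, P r -> u r < v r.
Proof.
move=> cu cv Pt uv; have d0 : 0 < (v t - u t) / 2 by lra.
apply: filterS2 (cu t Pt _ d0) (cv t Pt _ d0) => r hu hv Pr.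
by have := hu Pr; have := hv Pr; rewrite !ltr_distl; lra.
Qed.

Lemma curve_cst P x : cont_on P (fun=> x).
Proof. by move=> t Pt e e0; near=> r; rewrite subrr normr0.
Unshelve. all: by end_near. Qed.

Lemma curveD P u v : cont_on P u -> cont_on P v -> cont_on P (fun t => u t + v t).
Proof.
by move=> /cont_onP cu /cont_onP cv; apply/cont_onP => t; apply: continuousD; [exact: cu|exact: cv].
Qed.

Lemma curveN P u : cont_on P u -> cont_on P (fun t => - u t).
Proof. by move=> /cont_onP cu; apply/cont_onP => t; apply: continuousN; exact: cu. Qed.

Lemma curveM P u v : cont_on P u -> cont_on P v -> cont_on P (fun t => u t * v t).
Proof.
by move=> /cont_onP cu /cont_onP cv; apply/cont_onP => t; apply: continuousM; [exact: cu|exact: cv].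
Qed.

Lemma curveV P u : cont_on P u -> (forall t, P t -> u t != 0) ->
  cont_on P (fun t => (u t)^-1).
Proof.
move=> /cont_onP/subspace_continuousP cu u0; apply/cont_onP/subspace_continuousP => t Pt.
by apply: cvgV; [exact: u0|exact: cu].
Qed.

Lemma curve_max P u v : cont_on P u -> cont_on P v ->
  cont_on P (fun t => Num.max (u t) (v t)).
Proof.
move=> cu cv t Pt e e0.
apply: filterS2 (cu t Pt _ e0) (cv t Pt _ e0) => r hu hv Pr.
have := hu Pr; have := hv Pr; rewrite !ltr_distl.
by case: (leP (u r) (v r)); case: (leP (u t) (v t)); lra.
Qed.

(* Joint continuity of [(t, x) |-> f t x] on the region [a t <= x <= b t]. *)
Definition jcont P a b f := forall t, P t -> forall x, a t <= x <= b t ->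
  forall e, 0 < e -> exists2 d, 0 < d & \forall r \near t, P r ->
    forall y, a r <= y <= b r -> `|y - x| < d -> `|f r y - f t x| < e.

Lemma jcont_curve P a b f u : jcont P a b f -> cont_on P u ->
  (forall t, P t -> a t <= u t <= b t) -> cont_on P (fun t => f t (u t)).
Proof.
move=> jf cu abu t Pt e e0; have [d d0 H] := jf t Pt _ (abu _ Pt) e e0.
apply: filterS2 H (cu t Pt d d0) => r H1 H2 Pr.
by apply: H1; [|exact: abu|exact: H2].
Qed.

Lemma jcont_cont_on P a b f t : jcont P a b f -> P t -> cont_on `[a t, b t] (f t).
Proof.
move=> jf Pt x /=; rewrite in_itv /= => hx e e0.
have [d d0 /nbhs_singleton H] := jf t Pt _ hx e e0.
apply: filterS (near_dist x d0) => y hy; rewrite in_itv /= => yab.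
exact: H.
Qed.

Lemma jcont_sub P P' a b a' b' f f' : P' `<=` P ->
  (forall t, P' t -> a t <= a' t /\ b' t <= b t) ->
  (forall t x, P' t -> a' t <= x <= b' t -> f t x = f' t x) ->
  jcont P a b f -> jcont P' a' b' f'.
Proof.
move=> PP ab ff jf t Pt x hx e e0.
have [|d d0 H] := jf t (PP _ Pt) x _ e e0; first by have := ab _ Pt; lra.
exists d => //; apply: filterS H => r H Pr y hy yx.
rewrite -!ff //; apply: H => //; first exact: PP.
by have := ab _ Pr; lra.
Qed.

Lemma jcont_comp P a b f a' b' f' : jcont P a b f ->
  (forall t x, P t -> a t <= x <= b t -> a' t <= f t x <= b' t) ->
  jcont P a' b' f' -> jcont P a b (fun t x => f' t (f t x)).
Proof.
move=> jf ab jf' t Pt x hx e e0.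
have [d d0 H] := jf' t Pt (f t x) (ab _ _ Pt hx) e e0.
have [d' d0' H'] := jf t Pt x hx d d0.
exists d' => //; apply: filterS2 H H' => r H H' Pr y hy yx.
by apply: H => //; [exact: ab|exact: H'].
Qed.

Lemma near_lt_jcont P a b f e x t u : is_sign e -> jcont P a b f ->
  cont_on P a -> cont_on P b -> cont_on P u -> P t ->
  a t < x < b t -> e * u t < e * f t x ->
  \forall r \near t, P r -> a r < x < b r /\ e * u r < e * f r x.
Proof.
move=> se jf ca cb cu Pt /andP[ax xb] lt.
have cx := @curve_cst P x.
have ax' := near_lt_curve ca cx Pt ax; have xb' := near_lt_curve cx cb Pt xb.
have d0 : 0 < (e * f t x - e * u t) / 2 by lra.
have [|d dpos H] := jf t Pt x _ _ d0; first lra.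
have H2 := cu t Pt _ d0.
apply: filterS2 (filterI ax' xb') (filterI H H2) => r [h1 h2] [h3 h4] Pr.
move: (h1 Pr) (h2 Pr) (h4 Pr) => ? ? h5; split; first lra.
have := h3 Pr x ltac:(lra) ltac:(rewrite subrr normr0 //); move: h5.
rewrite !ltr_distl.
by case: se d0 lt => -> *; lra.
Qed.

(** A fixed test point slightly to one side of the solution at [t] has a value strictly beyond
    [u t]. This inequality is open in the parameter, and monotonicity turns it into a bound on the
    nearby solutions. When the test point would leave the interval, continuity of the endpoint gives
    the bound. *)
Lemma binv_curve P a b f e u : is_sign e -> jcont P a b f ->
  cont_on P a -> cont_on P b -> cont_on P u ->
  (forall t, P t -> a t <= b t) ->
  (forall t, P t -> smono e (f t) (a t) (b t)) ->
  (forall t, P t -> e * f t (a t) <= e * u t <= e * f t (b t)) ->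
  cont_on P (fun t => binv (f t) (a t) (b t) (u t)).
Proof.
move=> se jf ca cb cu ab mf hu t Pt eps eps0.
have bP r (Pr : P r) := binvP se (jcont_cont_on jf Pr) (ab _ Pr) (hu _ Pr).
set i := fun t => binv (f t) (a t) (b t) (u t).
have [it fit] := bP t Pt; rewrite -/(i t) in it fit.
have up : \forall r \near t, P r -> i r < i t + eps.
  have [bx|xb] := ltP (b t) (i t + eps).
    apply: filterS (near_lt_curve cb (@curve_cst P _) Pt bx) => r H Pr.
    by have := H Pr; have := (bP _ Pr).1; rewrite -/(i r); lra.
  have hz0 : a t < i t + eps / 2 < b t by lra.
  have lt : e * u t < e * f t (i t + eps / 2).
    by rewrite -{1}fit (smono_lt (mf t Pt)); lra.
  apply: filterS (near_lt_jcont se jf ca cb cu Pt hz0 lt) => r H Pr.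
  have [hz] := H Pr; have [ir fir] := bP r Pr; rewrite -/(i r) in ir fir.
  by rewrite -fir (smono_lt (mf r Pr)); lra.
have down : \forall r \near t, P r -> i t - eps < i r.
  have [bx|xb] := ltP (i t - eps) (a t).
    apply: filterS (near_lt_curve (@curve_cst P _) ca Pt bx) => r H Pr.
    by have := H Pr; have := (bP _ Pr).1; rewrite -/(i r); lra.
  have hz0 : a t < i t - eps / 2 < b t by lra.
  have lt : - e * u t < - e * f t (i t - eps / 2).
    by rewrite !mulNr ltrN2 -{1}fit (smono_lt (mf t Pt)); lra.
  have se' : is_sign (- e) by case: se => ->; [right|left; rewrite opprK].
  apply: filterS (near_lt_jcont se' jf ca cb cu Pt hz0 lt) => r H Pr.
  have [hz] := H Pr; have [ir fir] := bP r Pr; rewrite -/(i r) in ir fir.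
  by rewrite !mulNr ltrN2 -fir (smono_lt (mf r Pr)); lra.
apply: filterS2 up down => r h1 h2 Pr; rewrite ltr_distl.
by have := h1 Pr; have := h2 Pr; rewrite /i; lra.
Qed.

(** The definition of a family does not mention how the turning point moves. If it jumped past a
    fixed point [z] near [c t], then [c t] and [z] would lie on the same monotone side, which
    reverses the inequality between their values; but that inequality is open in the parameter. *)
Lemma turning_curve P a b c f s : is_sign s -> jcont P a b f ->
  cont_on P a -> cont_on P b ->
  (forall t, P t -> a t < c t < b t) ->
  (forall t, P t -> smono (- s) (f t) (a t) (c t)) ->
  (forall t, P t -> smono s (f t) (c t) (b t)) ->
  cont_on P c.
Proof.
move=> ss jf ca cb abc ml mr t Pt eps eps0.
have key z : a t < z < b t -> s * f t (c t) < s * f t z ->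
    \forall r \near t, P r -> [/\ a r < z < b r, a r < c t < b r &
      s * f r (c t) < s * f r z].
  move=> hz lt; have d0 : 0 < (s * f t z - s * f t (c t)) / 2 by lra.
  have cu := @curve_cst P ((f t z + f t (c t)) / 2).
  have H1 := near_lt_jcont ss jf ca cb cu Pt hz ltac:(rewrite /=; lra).
  have ss' : is_sign (- s) by case: ss => ->; [right|left; rewrite opprK].
  have H2 := near_lt_jcont ss' jf ca cb cu Pt (abc t Pt) ltac:(rewrite /=; lra).
  apply: filterS2 H1 H2 => r H1 H2 Pr.
  have [h1 h2] := H1 Pr; have [h3 h4] := H2 Pr; split => //.
  by lra.
have abt := abc t Pt.
have up : \forall r \near t, P r -> c r < c t + eps.
  have [bx|xb] := ltP (b t) (c t + eps).
    apply: filterS (near_lt_curve cb (@curve_cst P _) Pt bx) => r H Pr.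
    by have := H Pr; have := abc r Pr; lra.
  have := key (c t + eps / 2) ltac:(lra) ltac:(apply: (mr t Pt); lra).
  apply: filterS => r H Pr; have [h1 h2 h3] := H Pr.
  rewrite ltNge; apply/negP => h4.
  by have := ml r Pr (c t) (c t + eps / 2) ltac:(lra) ltac:(lra) ltac:(lra); lra.
have down : \forall r \near t, P r -> c t - eps < c r.
  have [bx|xb] := ltP (c t - eps) (a t).
    apply: filterS (near_lt_curve (@curve_cst P _) ca Pt bx) => r H Pr.
    by have := H Pr; have := abc r Pr; lra.
  have := key (c t - eps / 2) ltac:(lra)
    ltac:(have := ml t Pt (c t - eps / 2) (c t) ltac:(lra) ltac:(lra) ltac:(lra); lra).
  apply: filterS => r H Pr; have [h1 h2 h3] := H Pr.
  rewrite ltNge; apply/negP => h4.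
  by have := mr r Pr (c t - eps / 2) (c t) ltac:(lra) ltac:(lra) ltac:(lra); lra.
apply: filterS2 up down => r h1 h2 Pr; rewrite ltr_distl.
by have := h1 Pr; have := h2 Pr; lra.
Qed.

Lemma first_zero (a b : R) u : a <= b -> cont_on `[a, b] u -> u a <= 0 -> 0 <= u b ->
  exists2 c, a <= c <= b & u c = 0 /\ forall t, a <= t <= c -> u t <= 0.
Proof.
move=> ab cu ua ub.
pose S : set R := [set t | a <= t <= b /\ forall r, a <= r <= t -> u r <= 0].
have Sa : S a by split=> [|r hr]; [lra|have -> : r = a by lra].
have hS : has_sup S by split; [exists a|exists b => t [ht _]; lra].
pose c := sup S.
have ac : a <= c by apply: ub_le_sup => //; exact: hS.2.
have cb : c <= b by apply: ge_sup => [|t [ht _]]; [exists a|lra].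
have below r : a <= r < c -> u r <= 0.
  move=> hr; have [t [ht H] rt] := sup_adherent (eps := c - r) ltac:(lra) hS.
  by apply: H; rewrite subKr in rt; lra.
have cab : [set` `[a, b]] c by rewrite /= in_itv /=; lra.
have uc0 : u c <= 0.
  rewrite leNgt; apply/negP => uc; have [d d0 H] := near_dist_ex (cu c cab _ uc).
  have [ca|ca] := leP c a; first by have E : c = a by [lra]; rewrite E in uc; lra.
  have [r [h1 h2 h3]] : exists r, [/\ a <= r, r < c & c - d < r].
    exists (Num.max a (c - d / 2)); rewrite le_max lt_max gt_max; split; lra.
  have := H r ltac:(rewrite ltr_distl; lra) ltac:(rewrite /= in_itv /=; lra).
  by have := below r ltac:(lra); rewrite ltr_distl; lra.
have uc1 : 0 <= u c.
  rewrite leNgt; apply/negP => uc.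
  have [d d0 H] := near_dist_ex (cu c cab (- u c) ltac:(lra)).
  have cb' : c < b by rewrite lt_neqAle cb andbT; apply/eqP => E; rewrite E in uc; lra.
  have [r [h1 h2 h3]] : exists r, [/\ c < r, r <= b & r < c + d].
    exists (Num.min b (c + d / 2)); rewrite ge_min lt_min gt_min; split; lra.
  suff : r <= c by lra.
  apply: ub_le_sup; first exact: hS.2.
  split=> [|q hq]; first lra.
  have [qc|qc] := ltP q c; first by apply: below; lra.
  have := H q ltac:(rewrite ltr_distl; lra) ltac:(rewrite /= in_itv /=; lra).
  by rewrite ltr_distl; lra.
exists c; first lra; split; first lra.
move=> t ht; have [tc|tc] := ltP t c; first by apply: below; lra.
by have -> : t = c by lra.
Qed.

Lemma crossing (a b : R) w : a <= b -> cont_on `[a, b] w ->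
  (w a <= 0 /\ 1 <= w b) \/ (1 <= w a /\ w b <= 0) ->
  exists a' b' : R, [/\ a <= a', a' <= b', b' <= b,
    forall t, a' <= t <= b' -> 0 <= w t <= 1 &
    (w a' = 0 /\ w b' = 1) \/ (w a' = 1 /\ w b' = 0)].
Proof.
move=> ab; wlog hw : w / w a <= 0 /\ 1 <= w b.
  move=> H cw [h|h]; first by apply: H => //; left.
  have [|||a' [b' [h1 h2 h3 h4 h5]]] := H (fun t => 1 + (- w t)).
  - by lra.
  - by apply: curveD; [exact: curve_cst|exact: curveN].
  - by left; lra.
  by exists a', b'; split => // [t /h4|]; lra.
move=> cw _.
(* [b'] is the first parameter at which [w] is 1, and [a'] the last zero before it, found as a first
   zero after the reflection of the parameter. Between them [w] can leave [0, 1] on neither side. *)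
have [|||b' hb [wb Hb]] := @first_zero a b (fun t => w t + (-1)) ab; try lra.
  by apply: curveD => //; exact: curve_cst.
have wb' : w b' = 1 by lra.
have [||||a' ha [wa Ha]] := @first_zero (- b') (- a) (fun t => - w (- t)).
- by lra.
- move=> t /=; rewrite in_itv /= => ht e e0.
  have [d d0 H] := near_dist_ex (cw (- t) ltac:(rewrite /= in_itv /=; lra) e e0).
  apply: filterS (near_dist t d0) => r hr; rewrite in_itv /= => hr'.
  have := H (- r) ltac:(rewrite -opprD normrN; exact: hr) ltac:(rewrite /= in_itv /=; lra).
  by rewrite -opprD normrN.
- by rewrite opprK; lra.
- by rewrite opprK; lra.
exists (- a'), b'; split; try lra.
move=> t ht; have := Hb t ltac:(lra); have := Ha (- t) ltac:(lra).
by rewrite opprK; lra.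
Qed.

End Curves.

(** * Maps of class T *)

Section SpinMap.
Variables (R : realType) (G : spin_semigroup) (g : interval_map R).
Hypothesis gT : class_T_spin G g.

Definition eps (G : spin_semigroup) (k : int) : R := (spin G [:: k])%:~R.

Lemma eps_sign (G' : spin_semigroup) k : generator G' k -> is_sign (eps G' k).
Proof.
move=> hk; have hw : is_word (sneg G') (spos G') [:: k] by rewrite /is_word /= andbT.
by rewrite /eps; case: (spin_sign hw) => ->; [left|right].
Qed.

Lemma generator0 (G' : spin_semigroup) : generator G' 0.
Proof. by rewrite /generator /in_range; lia. Qed.

Lemma index_generator k : is_index g k = generator G k.
Proof. by case: gT => _ [qe pe _ _]; rewrite /is_index /generator qe pe. Qed.

Lemma lo_lt_hi k : generator G k -> lo g k < hi g k.
Proof. by rewrite -index_generator; case: gT => -[[H _] _ _ _ _] _; exact: H. Qed.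

Lemma hi_lt_lo i j : generator G i -> generator G j -> i < j -> hi g i < lo g j.
Proof. by rewrite -!index_generator; case: gT => -[[_ H] _ _ _ _] _; exact: H. Qed.

Lemma base_lt k : generator G k -> base_lo g < lo g k /\ hi g k < base_hi g.
Proof. by rewrite -index_generator; case: gT => -[_ H _ _ _] _; exact: H. Qed.

Lemma itvP k x : itv g k x <-> lo g k <= x <= hi g k.
Proof. by rewrite /itv /= in_itv. Qed.

Lemma dom_itv k x : generator G k -> lo g k <= x <= hi g k -> dom g x.
Proof. by move=> hk hx; exists k; [rewrite index_generator|apply/itvP]. Qed.

Lemma fn_base x : dom g x -> base_lo g <= fn g x <= base_hi g.
Proof.
case: gT => -[_ _ [H _] _ _] _ /H.
by rewrite /base_itv /= in_itv.
Qed.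

Lemma fn_cont_on_dom : cont_on (dom g) (fn g).
Proof. by apply/cont_onP; case: gT => -[_ _ [_ H] _ _] _. Qed.

Lemma fn_cont k : generator G k -> cont_on `[lo g k, hi g k] (fn g).
Proof.
move=> hk; apply: cont_onW fn_cont_on_dom => x /=; rewrite in_itv /=.
exact: dom_itv.
Qed.

Lemma fn_smono k : generator G k -> k <> 0 -> smono (eps G k) (fn g) (lo g k) (hi g k).
Proof.
move=> hk k0; case: gT => _ [_ _ H _].
have := H k; rewrite index_generator => /(_ hk k0) h x y lx xy yh.
have hx : itv g k x by apply/itvP; lra.
have hy : itv g k y by apply/itvP; lra.
by rewrite /eps; case: h => -[-> h]; rewrite ?mul1r ?mulN1r ?ltrN2; exact: h.
Qed.

Lemma fn_end k x : generator G k -> x = lo g k \/ x = hi g k ->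
  fn g x = base_lo g \/ fn g x = base_hi g.
Proof.
rewrite -index_generator => hk hx; case: gT => -[_ _ _ _ [H _]] _.
have [|->|->] := H k hk (fn g x); [|by left|by right].
by case: hx => ->; [left|right].
Qed.

Lemma fn_onto k y : generator G k -> k <> 0 -> base_lo g <= y <= base_hi g ->
  eps G k * fn g (lo g k) <= eps G k * y <= eps G k * fn g (hi g k).
Proof.
move=> hk k0 hy; have lt := lo_lt_hi hk.
have := fn_smono hk k0 (lexx _) lt (lexx _).
have := fn_end hk (or_introl erefl); have := fn_end hk (or_intror erefl).
by case: (eps_sign hk) => ->; case=> ->; case=> ->; lra.
Qed.

Definition orient := eps G 0.

Lemma orient_sign : is_sign orient.
Proof. exact/eps_sign/generator0. Qed.

Lemma crit_extremum x : lo g 0 <= x <= hi g 0 -> orient * fn g (crit g) <= orient * fn g x.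
Proof.
rewrite /orient /eps; case: gT => _ [_ _ _ H] hx.
by case: H => -[-> /(_ x)]; rewrite ?mul1r ?mulN1r ?lerN2; apply; apply/itvP.
Qed.

Lemma turning_crit x : turning_point g x <-> x = crit g.
Proof. by case: gT => -[_ _ _ [_ H] _] _. Qed.

Lemma crit_in : lo g 0 < crit g < hi g 0.
Proof.
case: gT => -[_ _ _ [/itvP hc _] _] _.
have [[k]] := (turning_crit (crit g)).2 erefl.
rewrite index_generator => hk; rewrite /itv_interior /= in_itv /= => hck _.
case: (ltgtP k 0) => [k0|k0|<- //].
  by have := hi_lt_lo hk (generator0 G) k0; lra.
by have := hi_lt_lo (generator0 G) hk k0; lra.
Qed.

Let g0 := generator0 G.

Lemma no_turning x : lo g 0 < x < hi g 0 -> x <> crit g ->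
  ~ ((\forall y \near x, fn g x <= fn g y) \/ (\forall y \near x, fn g y <= fn g x)).
Proof.
move=> hx xc H; apply/xc/turning_crit; split => //.
by exists 0; [rewrite index_generator|rewrite /itv_interior /= in_itv].
Qed.

(** Monotonicity comes from the absence of turning points in the half, its direction from the
    extremum at [crit g]. *)
Lemma smono_left : smono (- orient) (fn g) (lo g 0) (crit g).
Proof.
have hc := crit_in.
have [| | |e se m] := @no_extremum_smono R (fn g) (lo g 0) (crit g); first lra.
- apply: cont_onW (fn_cont g0) => x /=; rewrite !in_itv /=; lra.
- move=> x hx; apply: no_turning; first lra.
  by move=> E; rewrite E in hx; lra.
have := m _ _ (lexx _) _ (lexx _); have := @crit_extremum (lo g 0).
move: m; rewrite /smono; case: orient_sign => ->; case: se => -> m h1 h2;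
  have := h1 ltac:(lra); have := h2 ltac:(lra); try lra; move=> _ _.
- exact: m.
- by rewrite opprK.
Qed.

Lemma smono_right : smono orient (fn g) (crit g) (hi g 0).
Proof.
have hc := crit_in.
have [| | |e se m] := @no_extremum_smono R (fn g) (crit g) (hi g 0); first lra.
- apply: cont_onW (fn_cont g0) => x /=; rewrite !in_itv /=; lra.
- move=> x hx; apply: no_turning; first lra.
  by move=> E; rewrite E in hx; lra.
have := m _ _ (lexx _) _ (lexx _); have := @crit_extremum (hi g 0).
move: m; rewrite /smono; case: orient_sign => ->; case: se => -> m h1 h2;
  have := h1 ltac:(lra); have := h2 ltac:(lra); try lra; move=> _ _.
- exact: m.
- exact: m.
Qed.

(* The end of the base interval to which both ends of I_0 are mapped. *)
Definition fold_end := if orient == 1 then base_hi g else base_lo g.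

(** Both ends have values strictly on one side of the critical value, and only one end of the base
    interval is left on that side. *)
Lemma fold_endP x : x = lo g 0 \/ x = hi g 0 -> fn g x = fold_end.
Proof.
have hc := crit_in; have hb : base_lo g < base_hi g by have := base_lt g0; lra.
have l : orient * fn g (crit g) < orient * fn g (lo g 0).
  by have := smono_left (lexx _) (_ : lo g 0 < crit g) (lexx _); rewrite !mulNr; lra.
have r : orient * fn g (crit g) < orient * fn g (hi g 0).
  by have := smono_right (lexx _) (_ : crit g < hi g 0) (lexx _); lra.
have bc : base_lo g <= fn g (crit g) <= base_hi g.
  by apply/fn_base/(dom_itv g0); lra.
rewrite /fold_end => hx; have := fn_end g0 hx; move: l r.
case: orient_sign => ->; rewrite ?eqxx ?mul1r ?mulN1r => l r.
  by case: hx => -> []; lra.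
have -> : ((-1 : R) == 1) = false by apply/eqP; lra.
by case: hx => -> []; lra.
Qed.

Lemma fold_end_max y : base_lo g <= y <= base_hi g -> orient * y <= orient * fold_end.
Proof.
rewrite /fold_end; case: orient_sign => -> hy; rewrite ?eqxx ?mul1r; first lra.
by have -> : ((-1 : R) == 1) = false by [apply/eqP; lra]; lra.
Qed.

Lemma fold_end_base : base_lo g <= fold_end <= base_hi g.
Proof. by have := base_lt g0; have := lo_lt_hi g0; rewrite /fold_end; case: ifP; lra. Qed.

(** An interval leaving I_k inside the domain would contain the midpoint of a gap between two
    neighbouring intervals, which is in none of them. This is what yields maximality of
    pull-backs. *)
Lemma interval_in_itv (B : set R) k x : is_interval B -> B `<=` dom g ->
  B x -> generator G k -> lo g k <= x <= hi g k ->
  forall y, B y -> lo g k <= y <= hi g k.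
Proof.
move=> iB Bd Bx hk hx y By.
have gap i x' y' : B x' -> B y' -> generator G i -> generator G (i + 1) ->
    x' <= hi g i -> lo g (i + 1) <= y' -> False.
  move=> Bx' By' hi1 hi2 h1 h2; have h3 := hi_lt_lo hi1 hi2 ltac:(lia).
  have [|j] := Bd ((hi g i + lo g (i + 1)) / 2).
    by apply: (iB x' y') => //; lra.
  rewrite index_generator => hj /itvP h4.
  have [ji|ij] := lerP j i.
    have : hi g j <= hi g i.
      move: ji; rewrite le_eqVlt => /orP[/eqP->//|ji].
      by have := hi_lt_lo hj hi1 ji; have := lo_lt_hi hi1; lra.
    lra.
  have : lo g (i + 1) <= lo g j.
    have : i + 1 <= j by lia.
    rewrite le_eqVlt => /orP[/eqP->//|ij'].
    by have := hi_lt_lo hi2 hj ij'; have := lo_lt_hi hi2; lra.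
  lra.
have [j] := Bd y By; rewrite index_generator => hj /itvP hy.
case: (ltgtP j k) => [jk|kj|<- //]; exfalso.
  apply: (gap j y x) => //; try lra.
    by move: hj hk; rewrite /generator /in_range; lia.
  have gj : generator G (j + 1) by move: hj hk; rewrite /generator /in_range; lia.
  have : j + 1 <= k by lia.
  rewrite le_eqVlt => /orP[/eqP->|jk']; first lra.
  by have := hi_lt_lo gj hk jk'; have := lo_lt_hi gj; lra.
apply: (gap k x y) => //; try lra.
  by move: hj hk; rewrite /generator /in_range; lia.
have gj : generator G (k + 1) by move: hj hk; rewrite /generator /in_range; lia.
have : k + 1 <= j by lia.
rewrite le_eqVlt => /orP[/eqP->|jk']; first lra.
by have := hi_lt_lo gj hj jk'; have := lo_lt_hi gj; lra.
Qed.

End SpinMap.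

(** * Words and their pull-backs *)

Section Words.
Variables (R : realType) (G : spin_semigroup).

Definition nonzero_word (v : seq int) := all (fun k => generator G k && (k != 0)) v.

Definition word_sign (v : seq int) : R := foldr (fun k e => e * eps R G k) 1 v.

(* [lex_vector] read from left to right: [c] is the spin of the letters already
   consumed. *)
Fixpoint signed_vector (c : int) (w : seq int) : seq int :=
  if w is k :: w' then c * k :: signed_vector (c * spin G [:: k]) w' else [::].

Lemma lex_vectorE w : in_semigroup G w -> lex_vector G w = signed_vector 1 w.
Proof.
case/andP => _ hw.
suff H c : all (generator G) w ->
  [seq c * ((if t == 0%N then 1 else spin G (take t w)) * nth 0 w t)
     | t <- iota 0 (size w)] = signed_vector c w.
  by rewrite /lex_vector -H //; apply: eq_map => t; rewrite mul1r.
elim: w c {hw} => [//|k w IH] c /andP[hk hw] /=.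
rewrite mul1r; congr cons; rewrite -IH //.
have -> : iota 1 (size w) = map (addn 1) (iota 0 (size w)) by rewrite -iotaDl addn0.
rewrite -map_comp.
apply/eq_in_map => t; rewrite mem_iota add0n => /andP[_ ht] /=.
rewrite ?add1n /= -!mulrA; congr (_ * _); rewrite mulrA; congr (_ * _).
case: t ht => [|t] ht; first by rewrite take0 /= mulr1.
rewrite -cat1s spin_cat // /is_word ?/= ?andbT //.
case: w hw ht {IH} => [//|l w] /andP[hl hw] _ /=.
rewrite [in_range _ _ l]hl; apply/allP => x /mem_take; exact: allP hw x.
Qed.

Lemma nonzero_wordW v : nonzero_word v -> in_semigroup G (rcons v 0).
Proof.
move=> hv; rewrite /in_semigroup /is_word; case: v hv => [|k v] hv /=.
  by rewrite andbT; exact: generator0.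
rewrite all_rcons [in_range _ _ 0]generator0 /=.
by apply: sub_all hv => l /andP[].
Qed.

Lemma in_W_word w : in_W G w -> exists2 v, nonzero_word v & w = rcons v 0.
Proof.
by move=> [v [-> h1 h2]]; exists v => //; rewrite /nonzero_word all_predI h1.
Qed.

Lemma word_sign_sign v : nonzero_word v -> is_sign (word_sign v).
Proof.
elim: v => [|k v IH] /=; first by left.
by move=> /andP[/andP[hk _] hv]; apply: sign_mul (IH hv) (eps_sign R hk).
Qed.

Lemma spin_word v : nonzero_word v ->
  (spin G (rcons v 0))%:~R = word_sign v * eps R G 0.
Proof.
elim: v => [|k v IH] /=; first by rewrite mul1r.
move=> /andP[/andP[hk k0] hv]; rewrite -cat1s spin_cat.
- by rewrite intrM IH // mulrA [_ * word_sign v]mulrC.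
- by rewrite /is_word /= andbT.
- exact: nonzero_wordW.
Qed.

End Words.

(** To be read with [a] and [b] the images of [x] and [y] under a map monotone in the direction [e].
    Both comparisons are required because the outer sign [c] may exchange the two points. *)
Lemma sign_lt_transfer (R : realType) (c e x y a b : R) : is_sign c -> is_sign e ->
  (e * a < e * b) = (x < y) -> (e * b < e * a) = (y < x) ->
  c * e * x < c * e * y -> c * a < c * b.
Proof.
by move=> [->|->] [->|->]; rewrite !(mulr1,mul1r,mulN1r,opprK,ltrN2) => E1 E2;
  rewrite ?E1 ?E2.
Qed.

Lemma int_sign (R : realType) (c : int) : c = 1 \/ c = -1 -> is_sign (c%:~R : R).
Proof. by case=> ->; [left|right]. Qed.

Section InverseWords.
Variables (R : realType) (G : spin_semigroup) (g : interval_map R).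
Hypothesis gT : class_T_spin G g.

Definition inv_branch (g : interval_map R) (k : int) : R -> R :=
  binv (fn g) (lo g k) (hi g k).

(* The point whose orbit visits the intervals I_k, for the letters k of [v] in
   turn, and then reaches [z]. *)
Definition inv_word (g : interval_map R) (v : seq int) (z : R) : R :=
  foldr (inv_branch g) z v.

Lemma base_sub k x : generator G k -> lo g k <= x <= hi g k ->
  base_lo g <= x <= base_hi g.
Proof. by move=> hk hx; have := base_lt gT hk; lra. Qed.

Lemma inv_branchP k y : generator G k -> k <> 0 -> base_lo g <= y <= base_hi g ->
  lo g k <= inv_branch g k y <= hi g k /\ fn g (inv_branch g k y) = y.
Proof.
move=> hk k0 hy; apply: (binvP (eps_sign R hk) (fn_cont gT hk) _ (fn_onto gT hk k0 hy)).
exact/ltW/(lo_lt_hi gT hk).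
Qed.

Lemma inv_branchK k x : generator G k -> k <> 0 -> lo g k <= x <= hi g k ->
  inv_branch g k (fn g x) = x.
Proof. by move=> hk k0; apply: binvK (fn_smono gT hk k0). Qed.

Lemma inv_branch_smono k : generator G k -> k <> 0 ->
  smono (eps R G k) (inv_branch g k) (base_lo g) (base_hi g).
Proof.
move=> hk k0 x y hx xy hy.
have hx' : base_lo g <= x <= base_hi g by lra.
have hy' : base_lo g <= y <= base_hi g by lra.
have [ix fx] := inv_branchP hk k0 hx'; have [iy fy] := inv_branchP hk k0 hy'.
have H := smono_lt (fn_smono gT hk k0) ix iy.
have H' := smono_lt (fn_smono gT hk k0) iy ix.
move: H H'; rewrite fx fy.
by case: (eps_sign R hk) => ->; rewrite ?mul1r ?mulN1r ?ltrN2 => H H';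
  [rewrite -H|rewrite -H'].
Qed.

Lemma inv_word_base v z : nonzero_word G v -> base_lo g <= z <= base_hi g ->
  base_lo g <= inv_word g v z <= base_hi g.
Proof.
elim: v => [//|k v IH] /= /andP[/andP[hk /eqP k0] hv] hz.
by apply: (base_sub hk); have [] := inv_branchP hk k0 (IH hv hz).
Qed.

Lemma inv_word_smono v : nonzero_word G v ->
  smono (word_sign R G v) (inv_word g v) (base_lo g) (base_hi g).
Proof.
elim: v => [|k v IH] /=; first by move=> _ x y _ xy _; rewrite !mul1r.
move=> /andP[/andP[hk /eqP k0] hv].
apply: (smono_comp (word_sign_sign R hv) (IH hv) _ (inv_branch_smono hk k0)).
by move=> x; exact: inv_word_base.
Qed.

Lemma iter_inv_word v z i : nonzero_word G v -> base_lo g <= z <= base_hi g ->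
  (i <= size v)%N -> iter i (fn g) (inv_word g v z) = inv_word g (drop i v) z.
Proof.
move=> hv hz; elim: i v hv => [|i IH] v hv; first by rewrite drop0.
case: v hv => [//|k v] /= /andP[/andP[hk /eqP k0] hv] iv.
have [_ E] := inv_branchP hk k0 (inv_word_base hv hz).
by rewrite -iterS iterSr E IH.
Qed.

Lemma inv_word_mem v z i : nonzero_word G v -> base_lo g <= z <= base_hi g ->
  (i < size v)%N ->
  lo g (nth 0 v i) <= iter i (fn g) (inv_word g v z) <= hi g (nth 0 v i).
Proof.
move=> hv hz iv; rewrite iter_inv_word // 1?ltnW // (drop_nth 0) //=.
have hv' : nonzero_word G (drop i.+1 v) by apply/allP => x /mem_drop; exact: allP hv x.
have /andP[hk /eqP k0] := allP hv _ (mem_nth 0 iv).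
by have [] := inv_branchP hk k0 (inv_word_base hv' hz).
Qed.

(** An intermediate value property. [y] lies in the same I_k as the two bounds, so [fn g] carries
    the claim to the shorter word, and the inverse branch brings the solution back. *)
Lemma inv_word_between v a b y : nonzero_word G v -> a <= b ->
  base_lo g <= a -> b <= base_hi g ->
  inv_word g v a <= y <= inv_word g v b \/ inv_word g v b <= y <= inv_word g v a ->
  exists2 z, a <= z <= b & y = inv_word g v z.
Proof.
move=> hv ab la bh; elim: v hv y => [|k v IH] /= hv y.
  by move=> H; exists y => //; lra.
case/andP: hv => /andP[hk /eqP k0] hv H.
have [iA fA] := inv_branchP hk k0 (inv_word_base hv (z := a) ltac:(lra)).
have [iB fB] := inv_branchP hk k0 (inv_word_base hv (z := b) ltac:(lra)).
have hy : lo g k <= y <= hi g k by lra.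
have [|z hz E] := IH hv (fn g y).
  have m := smono_le (fn_smono gT hk k0).
  have := m _ _ iA hy; have := m _ _ iB hy; have := m _ _ hy iA; have := m _ _ hy iB.
  rewrite fA fB.
  by case: (eps_sign R hk) => ->; rewrite ?mul1r ?mulN1r ?lerN2 => -> -> -> ->; lra.
by exists z => //; rewrite -E inv_branchK.
Qed.

Lemma itv_lt (c : int) k l x y : c = 1 \/ c = -1 -> generator G k -> generator G l ->
  c * k < c * l -> lo g k <= x <= hi g k -> lo g l <= y <= hi g l ->
  (c%:~R : R) * x < c%:~R * y.
Proof.
move=> hc hk hl lt hx hy; case: hc lt => ->; rewrite ?mul1r ?mulN1r => lt.
  by rewrite ?mulr1z; have := hi_lt_lo gT hk hl lt; lra.
rewrite ?mulrNz ?mulr1z.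
by have := hi_lt_lo gT hl hk ltac:(lia); lra.
Qed.

(** At the first difference the two points lie in disjoint intervals I_k, ordered up to the spin [c]
    of the common prefix; every common letter is an inverse branch whose orientation multiplies [c]
    by the spin of that letter. Since 0 occurs only as last letter, a difference exists even between
    words of unequal length. *)
Lemma inv_word_lex (c : int) v w z z' : c = 1 \/ c = -1 ->
  nonzero_word G v -> nonzero_word G w ->
  (signed_vector G c (rcons v 0) < signed_vector G c (rcons w 0) :> seqlexi int)%O ->
  lo g 0 <= z <= hi g 0 -> lo g 0 <= z' <= hi g 0 ->
  (c%:~R : R) * inv_word g v z < c%:~R * inv_word g w z'.
Proof.
move=> hc hv hw lt hz hz'; have g0 := generator0 G.
have hzJ := base_sub g0 hz; have hzJ' := base_sub g0 hz'.
have head k s : generator G k -> k <> 0 -> nonzero_word G s -> forall t,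
    lo g 0 <= t <= hi g 0 -> lo g k <= inv_word g (k :: s) t <= hi g k.
  move=> hk k0 hs t ht.
  by have [] := inv_branchP hk k0 (inv_word_base hs (base_sub g0 ht)).
elim: v c w hc hv hw lt => [|k v IH] c [|l w] hc.
all: have c0 : c != 0 by case: hc => ->.
- by rewrite /= ltxx.
- move=> _ /andP[/andP[hl /eqP l0] hw]; rewrite rcons_cons /= Order.SeqLexiOrder.Exports.ltxi_cons.
  move=> /andP[le _]; apply: (itv_lt hc g0 hl _ hz); last exact: head.
  by rewrite lt_neqAle le andbT (inj_eq (mulfI c0)) eq_sym; apply/eqP.
- move=> /andP[/andP[hk /eqP k0] hv] _; rewrite rcons_cons /= Order.SeqLexiOrder.Exports.ltxi_cons.
  move=> /andP[le _]; apply: (itv_lt hc hk g0 _ _ hz'); last exact: head.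
  by rewrite lt_neqAle le andbT (inj_eq (mulfI c0)); apply/eqP.
- move=> hkv hlw; case/andP: (hkv) => /andP[hk /eqP k0] hv.
  case/andP: (hlw) => /andP[hl /eqP l0] hw.
  rewrite !rcons_cons /= Order.SeqLexiOrder.Exports.ltxi_cons => /andP[le].
  have [kl|kl] := eqVneq k l; last first.
    move=> _; apply: (itv_lt hc hk hl); [|exact: head..].
    by rewrite lt_neqAle le andbT (inj_eq (mulfI c0)).
  rewrite -{l}kl lexx /= in hl l0 le hlw * => lt.
  have hc' : c * spin G [:: k] = 1 \/ c * spin G [:: k] = -1.
    have hk' : is_word (sneg G) (spos G) [:: k] by rewrite /is_word /= andbT.
    by case: hc => ->; case: (spin_sign hk') => ->; rewrite ?mulrNN; [left|right|right|left].
  have := IH _ _ hc' hv hw lt.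
  have m := smono_lt (inv_branch_smono hk k0).
  have h1 := inv_word_base hv hzJ; have h2 := inv_word_base hw hzJ'.
  rewrite intrM; apply: sign_lt_transfer; [|exact: eps_sign hk|exact: m|exact: m].
  exact: int_sign.
Qed.

End InverseWords.

(** * Wandering intervals of return maps *)

Lemma iter_periodic (T : Type) (f : T -> T) (N : nat) (z : T) (n : nat) :
  iter N f z = z -> iter n f z = iter (n %% N) f z.
Proof.
move=> hz; have hq q : iter (q * N) f z = z.
  by elim: q => [//|q IH]; rewrite mulSn iterD IH hz.
by rewrite {1}(divn_eq n N) addnC iterD hq.
Qed.

Section OrderedIntervals.
Variables (R : realType) (h : interval_map R).
Hypothesis oh : ordered_intervals h.

Lemma finite_indices : finite_set [set k | is_index h k].
Proof.
apply: sub_finite_set (finite_image (fun n : nat => n%:Z - (nneg h)%:Z)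
  (finite_II (nneg h + npos h).+1)) => k /=.
rewrite /is_index /in_range => hk.
by exists (absz (k + (nneg h)%:Z)) => /=; lia.
Qed.

Lemma closed_dom : closed (dom h).
Proof.
have -> : dom h = \bigcup_(k in [set k | is_index h k]) itv h k by [].
apply: closed_bigcup; first exact: finite_indices.
by move=> k _; exact: itv_closed.
Qed.

Lemma itv_inj i j x : is_index h i -> is_index h j -> itv h i x -> itv h j x -> i = j.
Proof.
rewrite /itv /= !in_itv /= => hi hj hx hx'.
case: (ltgtP i j) => // ij; exfalso; case: oh => _ o.
  by have := o _ _ hi hj ij; lra.
by have := o _ _ hj hi ij; lra.
Qed.

Lemma near_same_itv j x : is_index h j -> itv h j x ->
  \forall y \near x, dom h y -> itv h j y.
Proof.
move=> hj hx.
pose D := \bigcup_(k in [set k | is_index h k /\ k <> j]) itv h k.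
have cD : closed D.
  apply: closed_bigcup => [|k _]; last exact: itv_closed.
  by apply: sub_finite_set finite_indices => k [].
have /near_dist_ex [d d0 H] : nbhs x (~` D).
  apply: open_nbhs_nbhs; split; first exact: closed_openC.
  by move=> [k [hk kj] hk']; apply: kj; exact: itv_inj hk hj hk' hx.
apply: filterS (near_dist x d0) => y /H Dy [k hk hky].
by have [<-//|kj] := eqVneq k j; exfalso; apply: Dy; exists k => //; split=> //; apply/eqP.
Qed.

Lemma cont_on_dom : (forall j, is_index h j -> cont_on (itv h j) (fn h)) ->
  cont_on (dom h) (fn h).
Proof.
move=> H x [j hj hx] e e0.
by apply: filterS2 (H j hj x hx e e0) (near_same_itv hj hx) => y H1 H2 /H2.
Qed.

Lemma interval_same_itv (B : set R) : is_interval B -> B `<=` dom h -> B !=set0 ->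
  exists2 j, is_index h j & B `<=` itv h j.
Proof.
move=> iB Bd [x Bx]; have [j hj hx] := Bd x Bx; exists j => //.
have cB : connected B by apply/connected_intervalP.
suff <- : B `&` itv h j = B by move=> y [].
apply: cB; first by exists x.
  pose D := \bigcup_(k in [set k | is_index h k /\ k <> j]) itv h k.
  exists (~` D).
    apply: closed_openC; apply: closed_bigcup => [|k _]; last exact: itv_closed.
    by apply: sub_finite_set finite_indices => k [].
  apply/seteqP; split=> y [By hy]; split=> //.
    by move=> [k [hk kj] hk']; apply: kj; exact: itv_inj hk hj hk' hy.
  have [k hk hky] := Bd y By.
  by have [<-//|kj] := eqVneq k j; exfalso; apply: hy; exists k => //; split=> //; apply/eqP.
exists (itv h j); first exact: itv_closed.
by [].
Qed.

End OrderedIntervals.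

(* An interval wandering for [h] is wandering for [g]: if two of its [g]-iterates
   met, pushing them forward to the next return would make two [h]-iterates meet.
   If it converged to a periodic orbit of [g], some point of that orbit would be
   a cluster point of an [h]-orbit, so that its own [h]-orbit is defined forever
   and consists of all the points of the orbit lying in I_0. *)
Section NoWandering.
Variables (R : realType) (g h : interval_map R) (s : int -> nat).
Hypothesis oh : ordered_intervals h.
Hypothesis ch : cont_on (dom h) (fn h).
Hypothesis ret : forall j y, is_index h j -> itv h j y ->
  first_return g y (s j) /\ fn h y = iter (s j) (fn g) y.

(** [T n] is the time of the n-th return. All points of [L] visit the same K_j at each step, hence
    share their return times. It serves for a wandering interval and for a single point of a
    periodic orbit. *)
Lemma return_times (L : set R) :
  (forall n, exists2 j, is_index h j & forall x, L x -> itv h j (iter n (fn h) x)) ->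
  exists T : nat -> nat, [/\ T 0%N = 0%N, forall n, (T n < T n.+1)%N,
    forall n x, L x -> iter n (fn h) x = iter (T n) (fn g) x,
    forall i x, L x -> dom g (iter i (fn g) x) &
    forall i x, L x -> itv g 0 (iter i (fn g) x) -> exists n, i = T n].
Proof.
move=> HL.
have /choice [j hj] : forall n, exists j, is_index h j /\ forall x, L x -> itv h j (iter n (fn h) x).
  by move=> n; have [j h1 h2] := HL n; exists j.
have [[x0 Lx0]|L0] := pselect (exists x, L x); last first.
  by exists id; split => // [n|i|i] x Lx; exfalso; apply: L0; exists x.
pose T := fix T n := if n is n'.+1 then (s (j n') + T n')%N else 0%N.
have iterT n x : L x -> iter n (fn h) x = iter (T n) (fn g) x.
  move=> Lx; elim: n => [//|n IH].
  have [h1 h2] := hj n; have [_ E] := ret h1 (h2 x Lx).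
  by rewrite iterS E IH -iterD.
have s0 n : (0 < s (j n))%N.
  by have [h1 h2] := hj n; have [[]] := ret h1 (h2 x0 Lx0).
have Tlt n : (T n < T n.+1)%N by rewrite /= -addn1 addnC leq_add2r.
have ex i : exists n, (T n <= i < T n.+1)%N.
  elim: i => [|i [n hn]]; first by exists 0%N; rewrite (Tlt 0%N).
  have [lt|ge] := ltnP i.+1 (T n.+1); first by exists n; lia.
  by exists n.+1; have := Tlt n.+1; lia.
have split_i i x (Lx : L x) : exists n, [/\ (T n <= i)%N, (i - T n < s (j n))%N &
    iter i (fn g) x = iter (i - T n) (fn g) (iter n (fn h) x)].
  have [n /andP[h1 h2]] := ex i; exists n; split => //.
    by move: h2 => /=; lia.
  by rewrite iterT // -iterD subnK.
exists T; split => //.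
  move=> i x Lx; have [n [h1 h2 ->]] := split_i i x Lx.
  have [h3 h4] := hj n; have [[_ _ H _ _] _] := ret h3 (h4 x Lx).
  exact: H.
move=> i x Lx; have [n [h1 h2 ->]] := split_i i x Lx.
have [h3 h4] := hj n; have [[_ _ _ H _] _] := ret h3 (h4 x Lx).
move=> hi; exists n; apply/eqP; rewrite eqn_leq h1 andbT leqNgt; apply/negP => lt.
by apply: (H (i - T n)%N) => //; lia.
Qed.

Definition clusters (f : R -> R) (u w : R) := forall e, 0 < e -> forall n0 : nat,
  exists2 n, (n0 <= n)%N & `|iter n f u - w| < e.

Lemma clusters_dom u w : (forall n, dom h (iter n (fn h) u)) ->
  clusters (fn h) u w -> dom h w.
Proof.
move=> hu aw; apply: contrapT => hw.
have /near_dist_ex [d d0 H] : nbhs w (~` dom h).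
  by apply: open_nbhs_nbhs; split => //; apply: closed_openC; exact: closed_dom.
by have [n _ /H] := aw d d0 0%N; apply.
Qed.

Lemma clusters_iter u w k : (forall n, dom h (iter n (fn h) u)) ->
  clusters (fn h) u w -> clusters (fn h) u (iter k (fn h) w).
Proof.
move=> hu aw; elim: k => [//|k IH] e e0 n0.
have [d d0 H] := near_dist_ex (ch (clusters_dom hu IH) e0).
have [n hn hd] := IH d d0 n0; exists n.+1; first exact: leqW.
by rewrite !iterS; apply: H.
Qed.

Lemma finite_min (N : nat) (P : nat -> R -> Prop) :
  (forall i, (i < N)%N -> exists2 e, 0 < e & P i e) ->
  (forall i e e', 0 < e' -> e' <= e -> P i e -> P i e') ->
  exists2 e, 0 < e & forall i, (i < N)%N -> P i e.
Proof.
move=> ex anti; elim: N ex => [|N IH] ex; first by exists 1.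
have [i iN|e e0 He] := IH; first by apply: ex; lia.
have [e' e'0 He'] := ex N (ltnSn N).
have m0 : 0 < Num.min e e' by rewrite lt_min e0.
exists (Num.min e e') => // i; rewrite ltnS leq_eqVlt => /orP[/eqP->|iN].
  by apply: anti He' => //; rewrite ge_min lexx orbT.
by apply: anti (He i iN) => //; rewrite ge_min lexx.
Qed.

Lemma converges_return (L : set R) (T : nat -> nat) u :
  L u -> (forall n x, L x -> dom h (iter n (fn h) x)) ->
  (forall n, (n <= T n)%N) ->
  (forall n x, L x -> iter n (fn h) x = iter (T n) (fn g) x) ->
  converges_to_periodic_orbit g L -> converges_to_periodic_orbit h L.
Proof.
move=> Lu Ldom Tn LT [z [N [N0 zdom zN conv]]].
have dom0 x : dom h x -> itv g 0 x by move=> [j hj /(ret hj) [[]]].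
(* Otherwise the [h]-orbit of [u] would from some time on stay at a fixed distance from all [N]
   points of the periodic orbit, against convergence along the times [T n]. *)
have [i0 i0N aw] : exists2 i, (i < N)%N & clusters (fn h) u (iter i (fn g) z).
  apply: contrapT => no.
  have [||e e0 He] := @finite_min N (fun i e => exists n0, forall n, (n0 <= n)%N ->
      e <= `|iter n (fn h) u - iter i (fn g) z|).
  - move=> i iN; apply: contrapT => no'; apply: no; exists i => // e e0 n0.
    apply: contrapT => no''; apply: no'; exists e => //.
    exists n0 => n hn; rewrite leNgt; apply/negP => lt; apply: no''.
    by exists n.
  - by move=> i e e' e'0 ee [n0 Hn]; exists n0 => n /Hn; exact: le_trans.
  have [n0 Hn0] : exists n0, forall i, (i < N)%N -> forall n, (n0 <= n)%N ->
      e <= `|iter n (fn h) u - iter i (fn g) z|.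
    have : forall M, (M <= N)%N -> exists n0, forall i, (i < M)%N -> forall n, (n0 <= n)%N ->
      e <= `|iter n (fn h) u - iter i (fn g) z|.
      elim=> [|M IH] hM; first by exists 0%N.
      have [n1 H1] := IH (ltnW hM); have [n2 H2] := He M hM.
      exists (maxn n1 n2) => i; rewrite ltnS leq_eqVlt => /orP[/eqP->|iM] n;
        rewrite geq_max => /andP[h1 h2]; [exact: H2|exact: H1].
    exact.
  have [M0 _ HM] := conv e e0.
  pose n := maxn n0 M0.
  have [|i iN] := HM (T n) _ u Lu.
    by rewrite /=; apply: leq_trans (Tn n); rewrite leq_maxr.
  by rewrite -LT // ltNge Hn0 // leq_maxl.
set w := iter i0 (fn g) z in aw.
have hw n : dom h (iter n (fn h) w).
  by apply: (@clusters_dom u); [move=> ?; exact: Ldom|apply: clusters_iter => // ?; exact: Ldom].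
have [n|S [S0 Slt SE _ SI]] := @return_times [set w].
  by have [j hj hx] := hw n; exists j => // x ->.
have wN : iter N (fn g) w = w by rewrite /w -iterD addnC iterD zN.
(* The orbit of [w] is back in I_0 at time [N], so [N] is one of its return times, and its index [M]
   is a period of [w] under [h]. *)
have [M NM] : exists n, N = S n.
  by apply: (SI N w) => //; rewrite wN; exact: (dom0 _ (hw 0%N)).
have M0 : (0 < M)%N by case: M NM N0 => [->|//]; rewrite S0.
have wM : iter M (fn h) w = w by rewrite SE // -NM.
(* [d] bounds from below the distance of I_0 to the orbit points outside it. An iterate in I_0 that
   is within [d] of an orbit point is therefore near one in I_0, that is, near a point of the
   [h]-orbit of [w]. *)
have [||d d0 Hd] := @finite_min N (fun i d => ~ itv g 0 (iter i (fn g) z) ->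
    forall y, itv g 0 y -> d <= `|y - iter i (fn g) z|).
- move=> i iN; have [hi|hi] := pselect (itv g 0 (iter i (fn g) z)).
    by exists 1.
  have /near_dist_ex [d d0 H] : nbhs (iter i (fn g) z) (~` itv g 0).
    by apply: open_nbhs_nbhs; split => //; apply: closed_openC; exact: itv_closed.
  by exists d => // _ y hy; rewrite leNgt; apply/negP => /H; apply.
- by move=> i e e' e'0 ee H /H {}H y /H; exact: le_trans.
exists w, M; split => // e e0.
have m0 : 0 < Num.min e d by rewrite lt_min e0.
have [M0' _ HM] := conv _ m0.
exists M0' => // n /= hn x Lx.
have [|i iN] := HM (T n) _ x Lx; first exact: leq_trans hn (Tn n).
rewrite -LT // lt_min => /andP[h1 h2].
have hI : itv g 0 (iter i (fn g) z).
  apply: contrapT => hI; have := Hd i iN hI _ (dom0 _ (Ldom n x Lx)).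
  by rewrite leNgt h2.
have zw : iter i (fn g) z = iter (i + (N - i0)) (fn g) w.
  by rewrite /w -iterD -addnA subnK ?(ltnW i0N) // iterD zN.
have [l Hl] : exists l, (i + (N - i0))%N = S l by apply: (SI _ w) => //; rewrite -zw.
exists (l %% M)%N; first exact: ltn_pmod.
by rewrite -(iter_periodic _ wM) (SE l w) // -Hl -zw.
Qed.

Lemma no_wandering_return : ~ (exists L, wandering_interval g L) ->
  ~ (exists L, wandering_interval h L).
Proof.
move=> ng [L [[u [v [uv LE]]] Ldom Ldisj Lnc]]; apply: ng.
have Lu : L u by rewrite LE /= in_itv /= lexx ltW.
have Lint n : is_interval (iter n (fn h) @` L).
  apply/connected_intervalP; elim: n => [|n IH].
    by rewrite image_id LE; apply/connected_intervalP; exact: interval_is_interval.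
  have -> : iter n.+1 (fn h) @` L = fn h @` (iter n (fn h) @` L).
    by rewrite -image_comp.
  apply: connected_continuous_connected => //; apply/cont_onP.
  by apply: cont_onW ch => _ [x Lx <-]; exact: Ldom.
have [n|T [T0 Tlt LT gdom TI]] := @return_times L.
  have [||j hj Hj] := interval_same_itv oh (Lint n).
  - by move=> _ [x Lx <-]; exact: Ldom.
  - by exists (iter n (fn h) u), u.
  by exists j => // x Lx; apply: Hj; exists x.
have Tn n : (n <= T n)%N by elim: n => [//|n IH]; exact: leq_ltn_trans IH (Tlt n).
exists L; split => //; first by exists u, v.
- suff disj m n : (m < n)%N -> (iter m (fn g) @` L) `&` (iter n (fn g) @` L) = set0.
    move=> m n; case: (ltngtP m n) => // mn _; first exact: disj.
    by rewrite setIC; exact: disj.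
  move=> mn; rewrite -subset0 => _ [[x Lx <-] [y Ly E]].
  (* The coincidence of the iterates [m] and [n] is pushed forward by [T m - m] steps to a return of
     [x], so [y] returns at that moment too. As [m < n], it is a return of a different index [l]. *)
  have E2 : iter (T m) (fn g) x = iter (T m - m + n) (fn g) y.
    by rewrite iterD E -iterD subnK.
  have [l Hl] : exists l, (T m - m + n)%N = T l.
    apply: (TI _ y) => //; rewrite -E2 -LT //.
    by have [j hj /(ret hj)[[]]] := Ldom m x Lx.
  have ml : m <> l by move=> ml; move: Hl; rewrite -ml; lia.
  have := Ldisj m l ml; rewrite -subset0 => /(_ (iter m (fn h) x)); apply.
  by split; [exists x|exists y => //; rewrite !LT // E2 Hl].
- by move=> H; apply: Lnc; exact: (converges_return Lu Ldom Tn LT H).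
Qed.

End NoWandering.

(** * Return maps of prescribed type *)

Section Halves.
Variables (R : realType) (G : spin_semigroup) (g : interval_map R).
Hypothesis gT : class_T_spin G g.

Let o : R := orient R G.

(* The right half of I_0 if [r], the left one otherwise. *)
Definition half_lo (g : interval_map R) (r : bool) := if r then crit g else lo g 0.
Definition half_hi (g : interval_map R) (r : bool) := if r then hi g 0 else crit g.
Definition half_sign (r : bool) : R := if r then orient R G else - orient R G.
Definition half_inv (g : interval_map R) (r : bool) :=
  binv (fn g) (half_lo g r) (half_hi g r).

Lemma half_sign_sign r : is_sign (half_sign r).
Proof.
by case: r; case: (orient_sign R G); rewrite /half_sign => ->; rewrite ?opprK;
  [left|right|right|left].
Qed.

Lemma half_sub r : lo g 0 <= half_lo g r /\ half_hi g r <= hi g 0.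
Proof. by have := crit_in gT; case: r => /=; lra. Qed.

Lemma half_lt r : half_lo g r < half_hi g r.
Proof. by have := crit_in gT; case: r => /=; lra. Qed.

Lemma half_smono r : smono (half_sign r) (fn g) (half_lo g r) (half_hi g r).
Proof. by case: r; [exact: smono_right gT|exact: smono_left gT]. Qed.

Lemma half_cont r : cont_on `[half_lo g r, half_hi g r] (fn g).
Proof.
apply: cont_onW (fn_cont gT (generator0 G)) => x /=; rewrite !in_itv /=.
by have := half_sub r; lra.
Qed.

Lemma half_range r y : base_lo g <= y <= base_hi g ->
  o * fn g (crit g) <= o * y ->
  half_sign r * fn g (half_lo g r) <= half_sign r * y <= half_sign r * fn g (half_hi g r).
Proof.
move=> hy hv; have m := fold_end_max G hy; rewrite -/o in m.
have l := fold_endP gT (or_introl erefl); have h := fold_endP gT (or_intror erefl).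
by case: r; rewrite /half_sign /= ?l ?h -/o ?mulNr; lra.
Qed.

Lemma half_invP r y : base_lo g <= y <= base_hi g -> o * fn g (crit g) <= o * y ->
  half_lo g r <= half_inv g r y <= half_hi g r /\ fn g (half_inv g r y) = y.
Proof.
move=> hy hv; have := half_lt r => /ltW ab.
exact: binvP (half_sign_sign r) (@half_cont r) ab (half_range r hy hv).
Qed.

End Halves.

(** * The intervals K_j and their description by itineraries *)

Section ReturnMap.
Variables (R : realType) (G G' : spin_semigroup) (chi : seq int -> seq int).

Definition letters (j : int) := take (size (chi [:: j])).-1 (chi [:: j]).

(* The end of I_0 to which an orientation preserving ([e = 1]) or reversing
   branch maps its left end. *)
Definition start_end (g : interval_map R) (e : R) := if e == 1 then lo g 0 else hi g 0.

(* The interval K_j lies in one half of I_0 if [j != 0], and its ends then go to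
   different ends of I_0; K_0 straddles the turning point, and both its ends go
   to the same end of I_0. *)
Definition ret_lo (g : interval_map R) (j : int) : R :=
  half_inv g (0 < j) (inv_word g (letters j)
    (start_end g (if j == 0 then - eps R G' j else eps R G' j))).

(** The tests [0 < j] in [ret_lo] and [0 <= j] here disagree only at [j = 0], where they select the
    left and the right half of I_0. *)
Definition ret_hi (g : interval_map R) (j : int) : R :=
  half_inv g (0 <= j) (inv_word g (letters j) (start_end g (- eps R G' j))).

Definition ret_index (g : interval_map R) (y : R) : int :=
  xget 0 [set j | generator G' j /\ ret_lo g j <= y <= ret_hi g j].

Definition return_of (g : interval_map R) : interval_map R :=
  IntervalMap (lo g 0) (hi g 0) (sneg G') (spos G') (ret_lo g) (ret_hi g)
    (fun y => iter (size (letters (ret_index g y))).+1 (fn g) y) (crit g).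

Hypothesis adm : admissible G' G chi.

Lemma lettersP j : generator G' j ->
  nonzero_word G (letters j) /\ chi [:: j] = rcons (letters j) 0.
Proof.
move=> hj; have [[_ H _ _ _] _] := adm.
have [v hv E] := in_W_word (H j hj).
by have -> : letters j = v by rewrite /letters E size_rcons /= -cats1 take_size_cat.
Qed.

Lemma letters_nonzero j : generator G' j -> nonzero_word G (letters j).
Proof. by move=> /lettersP[]. Qed.

(** This is where admissibility enters. The product of the spin of I_0 and [sgn1 j] is the direction
    of [g] on the half of I_0 containing K_j, so the prescribed spin is the orientation of the
    return branch; for [j = 0] it is the orientation on the right half. *)
Lemma eps_letters j : generator G' j ->
  eps R G' j = half_sign R G (0 <= j) * word_sign R G (letters j).
Proof.
move=> hj; have [_ H] := adm; have [hv E] := lettersP hj.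
rewrite {1}/eps H // intrM E spin_word // /sgn1 /half_sign /orient.
case: (leP 0 j) => _; first by rewrite mulr1z mul1r mulrC.
by rewrite mulrNz mulr1z mulN1r mulNr mulrC.
Qed.

Lemma W_ltP i j : generator G' i -> generator G' j ->
  W_lt G (chi [:: i]) (chi [:: j]) ->
  (signed_vector G 1 (rcons (letters i) 0) < signed_vector G 1 (rcons (letters j) 0) :> seqlexi int)%O.
Proof.
move=> hi hj; have [vi Ei] := lettersP hi; have [vj Ej] := lettersP hj.
by rewrite /W_lt Ei Ej !lex_vectorE ?nonzero_wordW.
Qed.

(** Strict monotonicity on a side leaves two directions open; the extremum at 0 excludes one of
    them. With the sign of the spin of I_0, words grow as the index moves away from 0. *)
Lemma unimodal_lt i j : generator G' i -> generator G' j ->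
  (0 <= i < j) \/ (j < i <= 0) ->
  if spin G [:: 0] == 1 then W_lt G (chi [:: i]) (chi [:: j])
  else W_lt G (chi [:: j]) (chi [:: i]).
Proof.
move=> hi hj hij; have [[_ _ Hl Hr [Hp Hn]] _] := adm.
have h0 := generator0 G'.
have s0 : spin G [:: 0] = 1 \/ spin G [:: 0] = -1.
  by apply: spin_sign; rewrite /is_word /= andbT; exact: generator0.
have Hle k : generator G' k -> if spin G [:: 0] == 1 then W_le G (chi [:: 0]) (chi [:: k])
    else W_le G (chi [:: k]) (chi [:: 0]).
  move=> hk; case: s0 => s0; rewrite s0 /=; [exact: Hp|exact: Hn].
have not_lt v w : W_le G v w -> W_lt G w v -> False.
  by rewrite /W_le /W_lt => h1 h2; have := Order.POrderTheory.lt_le_trans h2 h1; rewrite ltxx.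
have rng : - (sneg G')%:Z <= i <= (spos G')%:Z /\ - (sneg G')%:Z <= j <= (spos G')%:Z by [].
case: hij => hij.
- have h0j := Hle j hj.
  case: Hr => Hr; move: h0j; case: s0 => -> /= h0j.
  + by apply: Hr; lia.
  + by case: (not_lt _ _ h0j); apply: Hr; lia.
  + by case: (not_lt _ _ h0j); apply: Hr; lia.
  + by apply: Hr; lia.
- have h0j := Hle j hj.
  case: Hl => Hl; move: h0j; case: s0 => -> /= h0j.
  + by case: (not_lt _ _ h0j); apply: Hl; lia.
  + by apply: Hl; lia.
  + by apply: Hl; lia.
  + by case: (not_lt _ _ h0j); apply: Hl; lia.
Qed.

Section OneMap.
Variable g : interval_map R.
Hypothesis gT : class_T_spin G g.

Let o : R := orient R G.
Let g0 := generator0 G.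

Lemma I0_base z : lo g 0 <= z <= hi g 0 -> base_lo g <= z <= base_hi g.
Proof. exact: base_sub gT _ _ g0. Qed.

Lemma letters_lt i j z z' : generator G' i -> generator G' j ->
  (0 <= i < j) \/ (j < i <= 0) -> lo g 0 <= z <= hi g 0 -> lo g 0 <= z' <= hi g 0 ->
  o * inv_word g (letters i) z < o * inv_word g (letters j) z'.
Proof.
move=> hi hj hij hz hz'; have := unimodal_lt hi hj hij.
have vi := letters_nonzero hi; have vj := letters_nonzero hj.
have one : (1 : int) = 1 \/ (1 : int) = -1 by left.
have s0 : spin G [:: 0] = 1 \/ spin G [:: 0] = -1.
  by apply: spin_sign; rewrite /is_word /= andbT.
rewrite /o /orient /eps; case: s0 => -> /= /W_ltP.
  by move=> /(_ hi hj) lt; exact: (inv_word_lex gT one vi vj lt hz hz').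
move=> /(_ hj hi) lt; have := inv_word_lex gT one vj vi lt hz' hz.
by rewrite mulrNz mulr1z !mulNr !mul1r ltrN2.
Qed.

Lemma inv_letters_smono j : generator G' j ->
  smono (word_sign R G (letters j)) (inv_word g (letters j)) (base_lo g) (base_hi g).
Proof. by move=> hj; apply: inv_word_smono gT _ (letters_nonzero hj). Qed.

Lemma inv_letters_inner j z : generator G' j -> lo g 0 <= z <= hi g 0 ->
  base_lo g < inv_word g (letters j) z < base_hi g.
Proof.
move=> hj hz; have := letters_nonzero hj; case: (letters j) => [_|k v] /=.
  by have := base_lt gT g0; lra.
move=> /andP[/andP[hk /eqP k0] hv]; have := base_lt gT hk.
have [] := inv_branchP gT hk k0 (inv_word_base gT hv (I0_base hz)); lra.
Qed.

Lemma start_end_I0 e : lo g 0 <= start_end g e <= hi g 0.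
Proof. by have := crit_in gT; rewrite /start_end; case: ifP; lra. Qed.

(** [phi] is the point of I_0 reached by the turning point at its first return, and becomes the
    critical value of the return map. Being interior, it leaves room for a genuine fold in K_0. *)
Variable phi : R.
Hypothesis phi_in : lo g 0 < phi < hi g 0.
Hypothesis crit_value : fn g (crit g) = inv_word g (letters 0) phi.

Let g'0 := generator0 G'.

Lemma phi_I0 : lo g 0 <= phi <= hi g 0.
Proof. by case/andP: phi_in => h1 h2; rewrite !ltW. Qed.

Lemma crit_lt_letters j z : generator G' j -> j <> 0 -> lo g 0 <= z <= hi g 0 ->
  o * fn g (crit g) < o * inv_word g (letters j) z.
Proof.
move=> hj j0 hz; rewrite crit_value; apply: letters_lt => //; first lia.
exact: phi_I0.
Qed.

Lemma eps0 : eps R G' 0 = o * word_sign R G (letters 0).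
Proof. exact: eps_letters g'0. Qed.

Lemma start_end_eps e : is_sign e -> e * start_end g e < e * phi /\
  forall z, lo g 0 <= z <= hi g 0 -> e * start_end g e <= e * z.
Proof.
have -> : start_end g e = if e == 1 then lo g 0 else hi g 0 by [].
have hp := phi_in; case=> ->; first by rewrite eqxx; split=> [|z hz]; lra.
have -> : ((-1 : R) == 1) = false by apply/eqP; lra.
by split=> [|z hz]; lra.
Qed.

Lemma eps_opp_sign j : generator G' j -> is_sign (- eps R G' j).
Proof. by move=> /(eps_sign R)[->|->]; [right|left; rewrite opprK]. Qed.

Lemma letters0_smono z z' : lo g 0 <= z <= hi g 0 -> lo g 0 <= z' <= hi g 0 ->
  eps R G' 0 * z < eps R G' 0 * z' ->
  o * inv_word g (letters 0) z < o * inv_word g (letters 0) z'.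
Proof.
move=> hz hz'; have m := smono_lt (inv_letters_smono g'0).
have hzb := I0_base hz; have hzb' := I0_base hz'.
rewrite eps0; apply: sign_lt_transfer (m _ _ hzb hzb') (m _ _ hzb' hzb).
  exact: orient_sign.
exact/word_sign_sign/letters_nonzero.
Qed.

(* The value of the boundary of the central branch lies beyond the critical one. *)
Let tau := start_end g (- eps R G' 0).

Lemma tau_I0 : lo g 0 <= tau <= hi g 0.
Proof. exact: start_end_I0. Qed.

Lemma crit_lt_tau : o * fn g (crit g) < o * inv_word g (letters 0) tau.
Proof.
rewrite crit_value; apply: letters0_smono; first exact: phi_I0.
  exact: tau_I0.
by have [] := start_end_eps (eps_opp_sign g'0); rewrite !mulNr ltrN2.
Qed.

Lemma le_tau z : lo g 0 <= z <= hi g 0 ->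
  o * inv_word g (letters 0) z <= o * inv_word g (letters 0) tau.
Proof.
move=> hz; have [_ /(_ z hz)] := start_end_eps (eps_opp_sign g'0).
rewrite -/tau !mulNr lerN2 le_eqVlt => /orP[/eqP E|lt].
  have -> : z = tau by case: (eps_sign R g'0) E => ->; rewrite ?mul1r ?mulN1r // => /oppr_inj.
  by [].
by apply/ltW/letters0_smono => //; exact: tau_I0.
Qed.

Lemma half_inv_letters r j e : generator G' j -> (j = 0 -> e = - eps R G' 0) ->
  let x := half_inv g r (inv_word g (letters j) (start_end g e)) in
  half_lo g r <= x <= half_hi g r /\ fn g x = inv_word g (letters j) (start_end g e).
Proof.
move=> hj hje; have he := start_end_I0 e.
apply: (half_invP gT r (inv_word_base gT (letters_nonzero hj) (I0_base he))).
have [j0|/eqP j0] := eqVneq j 0; last by apply/ltW/crit_lt_letters.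
by rewrite j0 hje //; exact/ltW/crit_lt_tau.
Qed.

Lemma ret_loP j : generator G' j ->
  let e := start_end g (if j == 0 then - eps R G' j else eps R G' j) in
  half_lo g (0 < j) <= ret_lo g j <= half_hi g (0 < j) /\
  fn g (ret_lo g j) = inv_word g (letters j) e.
Proof. by move=> hj; apply: half_inv_letters => // ->; rewrite eqxx. Qed.

Lemma ret_hiP j : generator G' j ->
  half_lo g (0 <= j) <= ret_hi g j <= half_hi g (0 <= j) /\
  fn g (ret_hi g j) = inv_word g (letters j) (start_end g (- eps R G' j)).
Proof. by move=> hj; apply: half_inv_letters => // ->. Qed.

Definition on_side (j : int) (y : R) := (0 < j -> crit g <= y) /\ (j < 0 -> y <= crit g).

(** The values of [g] on I_0 lie on one side of the critical value, and [tau] gives the farthest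
    point of the pull-back on that side. Hence the points of I_0 mapped into the pull-back form a
    single interval around the turning point. *)
Lemma ret_mem0 y : ret_lo g 0 <= y <= ret_hi g 0 <->
  lo g 0 <= y <= hi g 0 /\ exists2 z, lo g 0 <= z <= hi g 0 & fn g y = inv_word g (letters 0) z.
Proof.
have [/= l fl] := ret_loP g'0; have [/= h fh] := ret_hiP g'0.
rewrite -/tau in fl; rewrite -/tau in fh.
have hp := phi_I0; have hc := crit_in gT; have ht := tau_I0; have v0 := letters_nonzero g'0.
split=> [hy|[hy [z hz fy]]].
  split; first lra.
  have btw : o * fn g (crit g) <= o * fn g y <= o * fn g (ret_lo g 0).
    have [yc|cy] := leP y (crit g).
      have m := smono_le (smono_left gT).
      have := m y (crit g) ltac:(lra) ltac:(lra); have := m (ret_lo g 0) y ltac:(lra) ltac:(lra).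
      by rewrite !mulNr !lerN2 => -> ->; lra.
    have m := smono_le (smono_right gT); rewrite fl -fh.
    have := m (crit g) y ltac:(lra) ltac:(lra); have := m y (ret_hi g 0) ltac:(lra) ltac:(lra).
    by move=> -> ->; lra.
  rewrite crit_value fl in btw.
  have base := base_lt gT g0.
  have H a b : lo g 0 <= a -> a <= b -> b <= hi g 0 ->
      inv_word g (letters 0) a <= fn g y <= inv_word g (letters 0) b \/
      inv_word g (letters 0) b <= fn g y <= inv_word g (letters 0) a ->
      exists2 z, lo g 0 <= z <= hi g 0 & fn g y = inv_word g (letters 0) z.
    move=> la ab bh /(inv_word_between gT v0 ab) [||z hz ->]; try lra.
    by exists z => //; lra.
  case: (leP phi tau) => pt; [apply: (H phi tau)|apply: (H tau phi)]; try lra.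
    by case: (orient_sign R G) btw; rewrite -/o => ->; rewrite ?mul1r ?mulN1r; lra.
  by case: (orient_sign R G) btw; rewrite -/o => ->; rewrite ?mul1r ?mulN1r; lra.
have le := le_tau hz; rewrite -fy in le.
have [yc|cy] := leP y (crit g).
  have := smono_le (smono_left gT) (x := ret_lo g 0) (y := y) ltac:(lra) ltac:(lra).
  by rewrite !mulNr !lerN2 fl le => /esym ?; lra.
have := smono_le (smono_right gT) (x := y) (y := ret_hi g 0) ltac:(lra) ltac:(lra).
by rewrite fh le => /esym ?; lra.
Qed.

(** For [j != 0] each half of I_0 contains an interval with the same image, and [on_side] selects
    one. Itineraries, first returns and maximality of the pull-backs are all read off this
    description. *)
Lemma ret_mem j y : generator G' j -> ret_lo g j <= y <= ret_hi g j <->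
  [/\ lo g 0 <= y <= hi g 0, on_side j y &
      exists2 z, lo g 0 <= z <= hi g 0 & fn g y = inv_word g (letters j) z].
Proof.
move=> hj; have [j0|j0] := eqVneq j 0.
  rewrite j0; split=> [/ret_mem0[h1 h2]|[h1 _ h2]]; last exact/ret_mem0.
  by split => //; split; rewrite ltxx.
have [l fl] := ret_loP hj; have [h fh] := ret_hiP hj.
have r : (0 < j) = (0 <= j) by lia.
have := start_end_eps (eps_sign R hj); have := start_end_eps (eps_opp_sign hj).
set a := start_end g (eps R G' j); set b := start_end g _ => - [_ hb] [_ ha].
have m := smono_lt (@half_smono _ _ _ gT (0 <= j)).
have ml := smono_le (@half_smono _ _ _ gT (0 <= j)).
have := half_sub gT (0 <= j) => - [s1 s2].
have hv := letters_nonzero hj.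
rewrite (negbTE j0) -/a r in fl l *; rewrite -/b in fh.
have Ia : lo g 0 <= a <= hi g 0 by exact: start_end_I0.
have Ib : lo g 0 <= b <= hi g 0 by exact: start_end_I0.
have base := base_lt gT g0.
split=> [hy|[hy sy [z hz fy]]].
  have hy' : half_lo g (0 <= j) <= y <= half_hi g (0 <= j) by lra.
  split; first lra.
    by split=> jj; move: hy'; rewrite /half_lo /half_hi;
      [rewrite (ltW jj)|rewrite [0 <= j]leNgt jj] => /=; lra.
  have btw : half_sign R G (0 <= j) * inv_word g (letters j) a <=
      half_sign R G (0 <= j) * fn g y <= half_sign R G (0 <= j) * inv_word g (letters j) b.
    by rewrite -fl -fh !ml //; lra.
  have H p q : lo g 0 <= p -> p <= q -> q <= hi g 0 ->
      inv_word g (letters j) p <= fn g y <= inv_word g (letters j) q \/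
      inv_word g (letters j) q <= fn g y <= inv_word g (letters j) p ->
      exists2 z, lo g 0 <= z <= hi g 0 & fn g y = inv_word g (letters j) z.
    move=> lp pq qh /(inv_word_between gT hv pq) [||z hz ->]; try lra.
    by exists z => //; lra.
  case: (leP a b) => ab; [apply: (H a b)|apply: (H b a)]; try lra;
    by case: (half_sign_sign R G (0 <= j)) btw => ->; rewrite ?mul1r ?mulN1r; lra.
have hy' : half_lo g (0 <= j) <= y <= half_hi g (0 <= j).
  rewrite /half_lo /half_hi; case: sy => sy1 sy2.
  by case: (leP 0 j) => jj; [have := sy1 ltac:(rewrite r //)|have := sy2 jj]; lra.
have key x x' : lo g 0 <= x <= hi g 0 -> lo g 0 <= x' <= hi g 0 ->
    eps R G' j * x <= eps R G' j * x' ->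
    half_sign R G (0 <= j) * inv_word g (letters j) x <=
    half_sign R G (0 <= j) * inv_word g (letters j) x'.
  move=> hx hx'; have hxb := I0_base hx; have hxb' := I0_base hx'.
  rewrite le_eqVlt => /orP[/eqP E|lt].
    have -> : x = x' by case: (eps_sign R hj) E => ->; rewrite ?mul1r ?mulN1r // => /oppr_inj.
    by [].
  apply: ltW; move: lt; rewrite (eps_letters hj).
  have mm := smono_lt (inv_letters_smono hj).
  apply: sign_lt_transfer (mm _ _ hxb hxb') (mm _ _ hxb' hxb); first exact: half_sign_sign.
  exact: word_sign_sign.
have h1 := key a z Ia hz (ha z hz).
have h2 := key z b hz Ib ltac:(have := hb z hz; lra).
by rewrite -fl -fy -fh !ml // in h1 h2; rewrite h1 h2.
Qed.

End OneMap.
End ReturnMap.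

Lemma sign_lt_transferV (R : realType) (c e x y a b : R) : is_sign c -> is_sign e ->
  (e * a < e * b) = (x < y) -> (e * b < e * a) = (y < x) ->
  c * a < c * b -> c * e * x < c * e * y.
Proof.
by move=> [->|->] [->|->]; rewrite !(mulr1,mul1r,mulN1r,opprK,ltrN2) => E1 E2;
  rewrite -?E1 -?E2.
Qed.

(** * The return map is of class T and has the prescribed type *)

Section ReturnMapClass.
Variables (R : realType) (G G' : spin_semigroup) (chi : seq int -> seq int).
Hypothesis adm : admissible G' G chi.
Variable g : interval_map R.
Hypothesis gT : class_T_spin G g.
Variable phi : R.
Hypothesis phi_in : lo g 0 < phi < hi g 0.
Hypothesis crit_value : fn g (crit g) = inv_word g (letters chi 0) phi.

Let o : R := orient R G.
Let g0 := generator0 G.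
Let g'0 := generator0 G'.
Let h := return_of G' chi g.
Let ret_mem j y (hj : generator G' j) := ret_mem adm gT phi_in crit_value y hj.

Lemma ret_orbit j y z : generator G' j -> lo g 0 <= z <= hi g 0 ->
  fn g y = inv_word g (letters chi j) z ->
  iter (size (letters chi j)).+1 (fn g) y = z.
Proof.
move=> hj hz fy; rewrite iterSr fy.
by rewrite (iter_inv_word gT (letters_nonzero adm hj) (I0_base gT hz)) // drop_size.
Qed.

Lemma ret_itinerary j y i : generator G' j -> ret_lo G' chi g j <= y <= ret_hi G' chi g j ->
  (i <= size (letters chi j))%N ->
  let k := nth 0 (0 :: letters chi j) i in
  [/\ generator G k, (0 < i)%N -> k <> 0 & lo g k <= iter i (fn g) y <= hi g k].
Proof.
move=> hj /(ret_mem y hj) [hy _ [z hz fy]].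
case: i => [|i] hi /=; first by split.
have hv := letters_nonzero adm hj.
have /andP[hk /eqP k0] := allP hv _ (mem_nth 0 hi).
split => //; rewrite -iterS iterSr fy.
exact: (inv_word_mem gT hv (I0_base gT hz) hi).
Qed.

Lemma ret0_crit : ret_lo G' chi g 0 < crit g < ret_hi G' chi g 0.
Proof.
have [/= l fl] := ret_loP adm gT phi_in crit_value g'0.
have [/= r fr] := ret_hiP adm gT phi_in crit_value g'0.
have lt := crit_lt_tau adm gT phi_in crit_value.
move: lt; rewrite -{1}fl => lt1.
have lt2 : orient R G * fn g (crit g) < orient R G * fn g (ret_hi G' chi g 0).
  by rewrite fr -fl.
apply/andP; split; rewrite lt_neqAle; apply/andP; split; try lra; apply/eqP => E.
  by rewrite E ltxx in lt1.
by rewrite -E ltxx in lt2.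
Qed.

Lemma ret_lt j : generator G' j -> ret_lo G' chi g j < ret_hi G' chi g j.
Proof.
move=> hj; have [j0|j0] := eqVneq j 0; first by have := ret0_crit; rewrite j0; lra.
have [l fl] := ret_loP adm gT phi_in crit_value hj.
have [r fr] := ret_hiP adm gT phi_in crit_value hj.
have r0 : (0 < j) = (0 <= j) by rewrite lt_neqAle eq_sym j0.
rewrite (negbTE j0) r0 in fl l.
rewrite -(smono_lt (@half_smono _ _ _ gT (0 <= j)) l r) fl fr.
have [h1 _] := start_end_eps phi_in (eps_sign R hj).
have [h2 _] := start_end_eps phi_in (eps_opp_sign R hj).
have Ia := start_end_I0 gT (eps R G' j); have Ib := start_end_I0 gT (- eps R G' j).
have m := smono_lt (inv_letters_smono adm gT hj).
have := m _ _ (I0_base gT Ia) (I0_base gT Ib).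
have := m _ _ (I0_base gT Ib) (I0_base gT Ia).
move=> m1 m2; apply: (sign_lt_transfer (half_sign_sign R G (0 <= j)) _ m2 m1).
  exact: word_sign_sign (letters_nonzero adm hj).
by rewrite -(eps_letters R adm hj); lra.
Qed.

Lemma ret_order i j : generator G' i -> generator G' j -> i < j ->
  ret_hi G' chi g i < ret_lo G' chi g j.
Proof.
have pos i' j' : generator G' i' -> generator G' j' -> 0 <= i' -> i' < j' ->
    ret_hi G' chi g i' < ret_lo G' chi g j'.
  move=> hi hj i0 ij.
  have [r fr] := ret_hiP adm gT phi_in crit_value hi.
  have [l fl] := ret_loP adm gT phi_in crit_value hj.
  rewrite i0 in r; rewrite (le_lt_trans i0 ij) in l.
  rewrite -(smono_lt (@half_smono _ _ _ gT true) r l) fr fl.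
  by apply: (letters_lt adm gT) => //; [left; rewrite i0|exact: start_end_I0 gT _..].
have neg i' j' : generator G' i' -> generator G' j' -> j' <= 0 -> i' < j' ->
    ret_hi G' chi g i' < ret_lo G' chi g j'.
  move=> hi hj j0 ij.
  have [r fr] := ret_hiP adm gT phi_in crit_value hi.
  have [l fl] := ret_loP adm gT phi_in crit_value hj.
  rewrite [0 <= i']leNgt (lt_le_trans ij j0) in r; rewrite [0 < j']ltNge j0 in l.
  rewrite -(smono_lt (@half_smono _ _ _ gT false) r l) fr fl /half_sign !mulNr ltrN2.
  by apply: (letters_lt adm gT) => //; [right; rewrite ij|exact: start_end_I0 gT _..].
move=> hi hj ij; have [i0|i0] := leP 0 i; first exact: pos.
have [j0|j0] := leP j 0; first exact: neg.
have := neg _ _ hi g'0 (lexx _) i0; have := pos _ _ g'0 hj (lexx _) j0.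
by have := ret_lt g'0; lra.
Qed.

(** Both ends of I_0 are sent to an end of the base interval, while the image of K_j lies in a
    pull-back strictly inside it. *)
Lemma ret_inner j : generator G' j ->
  lo g 0 < ret_lo G' chi g j /\ ret_hi G' chi g j < hi g 0.
Proof.
move=> hj; have lt := ret_lt hj; have hb := fold_end_base gT.
have strict y : ret_lo G' chi g j <= y <= ret_hi G' chi g j -> lo g 0 < y < hi g 0.
  move=> /(ret_mem y hj)[hy _ [z hz fy]].
  have := inv_letters_inner adm gT hj hz; rewrite -fy => inner.
  have ne : fn g y <> fold_end G g.
    by rewrite /fold_end => E; move: inner; rewrite E; case: ifP; rewrite ltxx ?andbF.
  rewrite !lt_neqAle; move: hy => /andP[-> ->]; rewrite !andbT.
  apply/andP; split; apply/eqP => E; apply: ne; apply: (fold_endP gT).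
    by left.
  by right.
have := strict (ret_lo G' chi g j) ltac:(lra).
have := strict (ret_hi G' chi g j) ltac:(lra).
by move=> /andP[_ ->] /andP[->].
Qed.

Lemma ret_indexP j y : generator G' j -> ret_lo G' chi g j <= y <= ret_hi G' chi g j ->
  ret_index G' chi g y = j.
Proof.
move=> hj hy; rewrite /ret_index; case: xgetP => [i _ [hi hy']|/(_ j)]; last by case.
case: (ltgtP i j) => // ij; exfalso.
  by have := ret_order hi hj ij; lra.
by have := ret_order hj hi ij; lra.
Qed.

Lemma ret_fn j y : generator G' j -> ret_lo G' chi g j <= y <= ret_hi G' chi g j ->
  fn h y = iter (size (letters chi j)).+1 (fn g) y.
Proof. by move=> hj hy; rewrite /h /return_of [LHS]/= (ret_indexP hj hy). Qed.

Lemma ret_value j y : generator G' j -> ret_lo G' chi g j <= y <= ret_hi G' chi g j ->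
  lo g 0 <= fn h y <= hi g 0 /\ fn g y = inv_word g (letters chi j) (fn h y).
Proof.
move=> hj hy; have /(ret_mem y hj) [_ _ [z hz fy]] := hy.
by rewrite (ret_fn hj hy) (ret_orbit hj hz fy).
Qed.

(** On K_j the map [g] is the inverse word applied to [h], so the direction of [h] is that of [g]
    times that of the word. The half [r] is free so that K_0 can be treated one half at a time. *)
Lemma ret_smono r j a b : generator G' j ->
  ret_lo G' chi g j <= a -> b <= ret_hi G' chi g j ->
  half_lo g r <= a -> b <= half_hi g r ->
  smono (half_sign R G r * word_sign R G (letters chi j)) (fn h) a b.
Proof.
move=> hj la bh la' bh' x y ax xy yb.
have hx : ret_lo G' chi g j <= x <= ret_hi G' chi g j by lra.
have hy : ret_lo G' chi g j <= y <= ret_hi G' chi g j by lra.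
have [zx fx] := ret_value hj hx; have [zy fy] := ret_value hj hy.
have hx' : half_lo g r <= x <= half_hi g r by lra.
have hy' : half_lo g r <= y <= half_hi g r by lra.
have m := smono_lt (inv_letters_smono adm gT hj).
have := m _ _ (I0_base gT zx) (I0_base gT zy).
have := m _ _ (I0_base gT zy) (I0_base gT zx).
move=> m1 m2; apply: (sign_lt_transferV (half_sign_sign R G r) _ m2 m1).
  exact: word_sign_sign (letters_nonzero adm hj).
by rewrite -fx -fy (smono_lt (@half_smono _ _ _ gT r) hx' hy').
Qed.

Lemma ret_smono_side j : generator G' j -> j <> 0 ->
  smono (eps R G' j) (fn h) (ret_lo G' chi g j) (ret_hi G' chi g j).
Proof.
move=> hj /eqP j0; rewrite (eps_letters R adm hj); apply: ret_smono => //.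
  have [l _] := ret_loP adm gT phi_in crit_value hj.
  by move: l; rewrite lt_neqAle eq_sym j0 /= => /andP[].
by have [/andP[_ ->] _] := ret_hiP adm gT phi_in crit_value hj.
Qed.

Lemma ret_smono_right : smono (eps R G' 0) (fn h) (crit g) (ret_hi G' chi g 0).
Proof.
have hc := ret0_crit; have hc' := ret_inner g'0.
rewrite (eps_letters R adm g'0); apply: (@ret_smono true) => //=; lra.
Qed.

Lemma ret_smono_left : smono (- eps R G' 0) (fn h) (ret_lo G' chi g 0) (crit g).
Proof.
have hc := ret0_crit; have hc' := ret_inner g'0.
rewrite (eps_letters R adm g'0) -mulNr; apply: (@ret_smono false) => //=; lra.
Qed.

Lemma ret_end j x : generator G' j -> x = ret_lo G' chi g j \/ x = ret_hi G' chi g j ->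
  fn h x = lo g 0 \/ fn h x = hi g 0.
Proof.
move=> hj hx; have lt := ret_lt hj.
have se e : start_end g e = lo g 0 \/ start_end g e = hi g 0.
  by rewrite /start_end; case: ifP; [left|right].
have [_ fl] := ret_loP adm gT phi_in crit_value hj.
have [_ fr] := ret_hiP adm gT phi_in crit_value hj.
have hx' : ret_lo G' chi g j <= x <= ret_hi G' chi g j by case: hx => ->; lra.
rewrite (ret_fn hj hx').
by case: hx => ->; rewrite (ret_orbit hj _ fl, ret_orbit hj _ fr) //; exact: start_end_I0 gT _.
Qed.

Lemma ret_crit : fn h (crit g) = phi.
Proof.
have hc := ret0_crit; have p0 := phi_I0 phi_in.
rewrite (@ret_fn 0 _ g'0); first by rewrite (ret_orbit g'0 p0 crit_value).
lra.
Qed.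

Lemma ret_ordered : ordered_intervals h.
Proof. by split=> [j hj|i j hi hj]; [exact: ret_lt|exact: ret_order]. Qed.

Lemma ret_first_return j y : generator G' j ->
  ret_lo G' chi g j <= y <= ret_hi G' chi g j ->
  first_return g y (size (letters chi j)).+1.
Proof.
move=> hj hy; have [hv _] := ret_value hj hy; rewrite (ret_fn hj hy) in hv.
split => //.
- by have [_ _] := ret_itinerary hj hy (leq0n _).
- move=> i hi; have [hk _ hik] := ret_itinerary hj hy (hi : (i <= _)%N).
  by have := dom_itv gT hk hik.
- move=> i /andP[i0 hi]; have [hk /(_ i0) k0 hik] := ret_itinerary hj hy (hi : (i <= _)%N).
  move=> hi0; apply: k0; have [[oo _ _ _ _] _] := gT.
  apply: (itv_inj oo _ _ (_ : itv g _ (iter i (fn g) y)) hi0).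
  + by rewrite (index_generator gT).
  + by rewrite (index_generator gT).
  + exact/itvP.
Qed.

Lemma ret_cont : cont_on (dom h) (fn h).
Proof.
apply: cont_on_dom; first exact: ret_ordered.
move=> j hj; have hit : forall i, (i <= size (letters chi j))%N ->
    cont_on `[ret_lo G' chi g j, ret_hi G' chi g j] (iter i.+1 (fn g)).
  elim=> [|i IH] hi.
    apply: cont_onW (fn_cont gT g0) => x /=; rewrite !in_itv /= => hx.
    by have [_ _] := ret_itinerary hj hx (leq0n _).
  have hl : ret_lo G' chi g j <= ret_lo G' chi g j <= ret_hi G' chi g j.
    by have := ret_lt hj; lra.
  have [hk _ _] := ret_itinerary hj hl hi.
  apply: (cont_on_comp (IH (ltnW hi)) _ (fn_cont gT hk)).
  by move=> x hx; have [] := ret_itinerary hj hx hi.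
have hc := hit _ (leqnn _).
move=> x hx e e0.
have hx0 : [set` `[ret_lo G' chi g j, ret_hi G' chi g j]] x by [].
apply: filterS (hc x hx0 e e0) => y H hy; have := H hy.
by move: hx hy => /itvP hx /itvP hy; rewrite !(ret_fn hj).
Qed.

Lemma ret_crit_extremum x : ret_lo G' chi g 0 <= x <= ret_hi G' chi g 0 ->
  eps R G' 0 * fn h (crit g) <= eps R G' 0 * fn h x.
Proof.
have hc := ret0_crit => hx; have [xc|cx] := leP x (crit g).
  have := smono_le ret_smono_left (x := x) (y := crit g) ltac:(lra) ltac:(lra).
  by rewrite !mulNr lerN2 xc => ->.
have := smono_le ret_smono_right (x := crit g) (y := x) ltac:(lra) ltac:(lra).
by rewrite (ltW cx) => ->.
Qed.

Lemma ret_spin : spin_semigroup_of h G'.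
Proof.
have sg k : generator G' k -> spin G' [:: k] = 1 \/ spin G' [:: k] = -1.
  by move=> hk; apply: spin_sign; rewrite /is_word /= andbT.
split => // [k hk k0|].
  have m := ret_smono_side hk k0; rewrite /eps in m.
  case: (sg k hk) => E; rewrite E in m; [left|right]; split => // x y /itvP hx /itvP hy xy.
    by have := m x y (proj1 (andP hx)) xy (proj2 (andP hy)); rewrite mulr1z !mul1r.
  by have := m x y (proj1 (andP hx)) xy (proj2 (andP hy)); rewrite mulrNz mulr1z !mulN1r ltrN2.
have m := ret_crit_extremum; rewrite /eps in m.
case: (sg 0 g'0) => E; rewrite E in m; [left|right]; split => // x /itvP /m.
  by rewrite mulr1z !mul1r.
by rewrite mulrNz mulr1z !mulN1r lerN2.
Qed.

Lemma ret_turning x : turning_point h x <-> x = crit g.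
Proof.
have hc := ret0_crit; split=> [[[j hj]]|->].
  rewrite /itv_interior /= in_itv /= => hx ext.
  have [j0|j0] := eqVneq j 0; last first.
    by case: (smono_not_extremum (eps_sign R hj) (ret_smono_side hj (elimN eqP j0)) hx).
  rewrite j0 in hx; case: (ltgtP x (crit g)) => // xc; exfalso.
    by apply: (smono_not_extremum (eps_opp_sign R g'0) ret_smono_left _ ext); lra.
  by apply: (smono_not_extremum (eps_sign R g'0) ret_smono_right _ ext); lra.
split; first by exists 0 => //; rewrite /itv_interior /= in_itv.
have N : \forall y \near crit g, ret_lo G' chi g 0 < y < ret_hi G' chi g 0.
  by case/andP: hc; exact: near_itvoo.
have m := ret_crit_extremum.
by case: (eps_sign R g'0) m => -> m; [left|right]; apply: filterS N => y hy;
  have := m y ltac:(lra); rewrite ?mul1r ?mulN1r ?lerN2.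
Qed.

Lemma ret_class_T : class_T h.
Proof.
split.
- exact: ret_ordered.
- by move=> k hk; exact: ret_inner hk.
- split; last by apply/cont_onP; exact: ret_cont.
  move=> x [j hj /itvP hx]; have [hv _] := ret_value hj hx.
  by rewrite /base_itv /= in_itv.
- by split; [apply/itvP; have := ret0_crit => /=; lra|exact: ret_turning].
- split.
    move=> k hk y /= [->|->]; apply: (ret_end hk); by [left|right].
  apply: (no_wandering_return (s := fun j => (size (letters chi j)).+1) ret_ordered ret_cont).
    move=> j y hj /itvP hy; split; [exact: ret_first_return|exact: ret_fn].
  by case: gT => -[_ _ _ _ [_ ng]] _.
Qed.

Lemma inv_word_interval v : nonzero_word G v -> is_interval (inv_word g v @` itv g 0).
Proof.
move=> hv _ _ [x /itvP hx <-] [y /itvP hy <-] z hz; have b := base_lt gT g0.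
have [xy|yx] := leP x y.
  have [||t ht ->] := inv_word_between gT hv xy _ _ (or_introl hz); try lra.
  by exists t => //; apply/itvP; lra.
have [||t ht ->] := inv_word_between gT hv (ltW yx) _ _ (or_intror hz); try lra.
by exists t => //; apply/itvP; lra.
Qed.

Lemma ret_pull_back j x : generator G' j -> ret_lo G' chi g j <= x <= ret_hi G' chi g j ->
  lo g 0 < fn h x < hi g 0 ->
  pull_back g x (size (letters chi j)).+1 (itv h j).
Proof.
move=> hj hx hfx; split.
  by rewrite /itv_interior /= in_itv /= -iterS -(ret_fn hj hx).
have hv := letters_nonzero adm hj.
have [hz fx] := ret_value hj hx; have hzb := I0_base gT hz.
have /(ret_mem x hj) [hx0 [sx1 sx2] _] := hx.
(* At time [i' + 1] only [i'] letters are dropped, because the starting interval I_0 is not a letter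
   of the word. *)
exists (fun i => if i is i'.+1 then inv_word g (drop i' (letters chi j)) @` itv g 0
                 else itv h j); split => //.
  by rewrite drop_size /= image_id.
case=> [_|i].
  rewrite drop0; split.
  - exact: interval_is_interval.
  - exact/itvP.
  - move=> y /itvP hy; have /(ret_mem y hj) [hy0 _ [z hz' fy]] := hy; split.
      by have := dom_itv gT g0 hy0.
    by exists z => //; exact/itvP.
  move=> B iB BE KB; apply/seteqP; split=> // y By; apply/itvP/(ret_mem y hj).
  have Bd : B `<=` dom g by move=> t /BE [].
  have Bx : B x by apply: KB; exact/itvP.
  have B0 := interval_in_itv gT iB Bd Bx g0 hx0.
  have Bimg t : B t -> exists2 z, lo g 0 <= z <= hi g 0 & fn g t = inv_word g (letters chi j) z.
    by move=> /BE [_ [z /itvP hz' E]]; exists z.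
  (* For [j != 0] the critical value is not in the pull-back, so an interval [B] mapped into it
     cannot cross the turning point and stays on the side of K_j. *)
  have nc : j <> 0 -> ~ B (crit g).
    move=> j0 /Bimg [z hz' E]; have := crit_lt_letters adm gT phi_in crit_value hj j0 hz'.
    by rewrite E ltxx.
  split; [exact: B0|split=> jj|exact: Bimg].
    rewrite leNgt; apply/negP => yc; apply: nc; first by move=> j0; rewrite j0 ltxx in jj.
    by apply: (iB y x) => //; rewrite (ltW yc) sx1.
  rewrite leNgt; apply/negP => yc; apply: nc; first by move=> j0; rewrite j0 ltxx in jj.
  by apply: (iB x y) => //; rewrite (ltW yc) sx2.
rewrite ltnS => hi; have hvi : nonzero_word G (drop i (letters chi j)).
  by apply/allP => k /mem_drop; exact: allP hv k.
have hvi' : nonzero_word G (drop i.+1 (letters chi j)).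
  by apply/allP => k /mem_drop; exact: allP hv k.
have := inv_word_interval hvi; rewrite (drop_nth 0 hi) in hvi *.
set k := nth 0 _ i in hvi *; set w := drop i.+1 _ in hvi hvi' *.
case/andP: (hvi) => /andP[hk /eqP k0] _ iI.
have brP z : itv g 0 z -> _ := fun hz' => inv_branchP gT hk k0 (inv_word_base gT hvi' (I0_base gT (proj1 (itvP g 0 z) hz'))).
have Mx : (inv_word g (k :: w) @` itv g 0) (iter i.+1 (fn g) x).
  exists (fn h x); first exact/itvP.
  by rewrite iterSr fx (iter_inv_word gT hv hzb (ltnW hi)) (drop_nth 0 hi).
split => //.
  move=> _ [z hz' <-]; have [h1 h2] := brP z hz'; split.
    by have := dom_itv gT hk h1.
  by exists z => //=; rewrite -[LHS]h2.
move=> B iB BE SB; apply/seteqP; split=> // y By.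
have Bd : B `<=` dom g by move=> t /BE [].
have [_ [z hz' fy]] := BE y By.
have [t /brP [ht _] E] := Mx.
have hy := interval_in_itv gT iB Bd (SB _ Mx) hk _ By.
exists z => //=; rewrite fy (inv_branchK gT hk k0) //; apply: hy.
by rewrite -E.
Qed.

Lemma ret_return_map : return_map g h.
Proof.
split => //; first exact: ret_ordered.
move=> j hj; have lt := ret_lt hj; have hc := ret0_crit; have hp := phi_in.
have fr y : itv h j y -> first_return g y (size (letters chi j)).+1 /\
    fn h y = iter (size (letters chi j)).+1 (fn g) y.
  by move=> /itvP hy; split; [exact: ret_first_return|exact: ret_fn].
have [j0|j0] := eqVneq j 0.
  exists (crit g), (size (letters chi j)).+1; split => //.
  - by apply: ret_first_return => //; rewrite j0; lra.
  - by apply: ret_pull_back => //; [rewrite j0; lra|rewrite ret_crit].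
(* Any interior point would do: by strict monotonicity its return lies in the interior of I_0, as a
   pull-back demands. *)
pose x := (ret_lo G' chi g j + ret_hi G' chi g j) / 2.
have hx : ret_lo G' chi g j <= x <= ret_hi G' chi g j by rewrite /x; lra.
exists x, (size (letters chi j)).+1; split => //.
- by move=> E; rewrite E eqxx in j0.
- exact: ret_first_return.
apply: ret_pull_back => //.
have m := ret_smono_side hj (elimN eqP j0).
have := m (ret_lo G' chi g j) x (lexx _) ltac:(rewrite /x; lra) ltac:(lra).
have := m x (ret_hi G' chi g j) ltac:(lra) ltac:(rewrite /x; lra) (lexx _).
have Il : ret_lo G' chi g j <= ret_lo G' chi g j <= ret_hi G' chi g j by lra.
have Ir : ret_lo G' chi g j <= ret_hi G' chi g j <= ret_hi G' chi g j by lra.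
have [hl _] := ret_value hj Il; have [hr _] := ret_value hj Ir.
by case: (eps_sign R hj) => ->; lra.
Qed.

Lemma ret_return_type : return_type g h G' G chi.
Proof.
split; [by case: gT|exact: ret_spin|by case: adm => -[]|].
move=> j hj; split; first by case: adm => -[_ H _ _ _] _; exact: H.
have [hv E] := lettersP adm hj; rewrite E size_rcons => i hi.
move=> _ [y /itvP hy <-]; apply/itvP; rewrite nth_rcons.
case: ltnP => hi'.
  by have [_ _] := ret_itinerary hj hy hi'.
have -> : i = size (letters chi j) by apply/eqP; rewrite eqn_leq hi' andbT.
by rewrite eqxx -(ret_fn hj hy); have [] := ret_value hj hy.
Qed.

End ReturnMapClass.

(** * Families of return maps *)

Section TameFamily.
Variable R : realType.
Implicit Types (P : set R) (g : R -> interval_map R).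

(** Joint continuity on the moving intervals, without rescaling, makes the notion stable under
    composing branches along an itinerary. Nothing is demanded of the turning point, whose
    continuity follows. *)
Definition tame_family (G : spin_semigroup) P g : Prop :=
  [/\ forall t, P t -> class_T_spin G (g t),
      cont_on P (fun t => base_lo (g t)) /\ cont_on P (fun t => base_hi (g t)),
      forall k, generator G k ->
        cont_on P (fun t => lo (g t) k) /\ cont_on P (fun t => hi (g t) k) &
      forall k, generator G k ->
        jcont P (fun t => lo (g t) k) (fun t => hi (g t) k) (fun t => fn (g t))].

Lemma tame_family_sub G P P' g : P' `<=` P -> tame_family G P g -> tame_family G P' g.
Proof.
move=> PP [gT [bl bh] lh j]; split.
- by move=> t /PP; exact: gT.
- by split; [exact: cont_onW bl|exact: cont_onW bh].
- by move=> k hk; have [l h] := lh k hk; split; [exact: cont_onW l|exact: cont_onW h].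
- by move=> k hk; apply: jcont_sub PP _ _ (j k hk) => // t _; rewrite !lexx.
Qed.

Section Curves.
Variables (G : spin_semigroup) (P : set R) (g : R -> interval_map R).
Hypothesis tame : tame_family G P g.

Let g0 := generator0 G.

Lemma tame_class t : P t -> class_T_spin G (g t).
Proof. by case: tame => H _ _ _; exact: H. Qed.

Lemma tame_lo k : generator G k -> cont_on P (fun t => lo (g t) k).
Proof. by case: tame => _ _ H _ /H[]. Qed.

Lemma tame_hi k : generator G k -> cont_on P (fun t => hi (g t) k).
Proof. by case: tame => _ _ H _ /H[]. Qed.

Lemma tame_jcont k : generator G k ->
  jcont P (fun t => lo (g t) k) (fun t => hi (g t) k) (fun t => fn (g t)).
Proof. by case: tame => _ _ _; apply. Qed.

Lemma crit_curve : cont_on P (fun t => crit (g t)).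
Proof.
apply: (turning_curve (orient_sign R G) (tame_jcont g0) (tame_lo g0) (tame_hi g0)) => t Pt.
- exact: crit_in (tame_class Pt).
- exact: smono_left (tame_class Pt).
- exact: smono_right (tame_class Pt).
Qed.

Lemma crit_value_curve : cont_on P (fun t => fn (g t) (crit (g t))).
Proof.
apply: (jcont_curve (tame_jcont g0) crit_curve) => t Pt.
by have := crit_in (tame_class Pt); lra.
Qed.

Lemma half_inv_curve r y : cont_on P y ->
  (forall t, P t -> base_lo (g t) <= y t <= base_hi (g t)) ->
  (forall t, P t -> orient R G * fn (g t) (crit (g t)) <= orient R G * y t) ->
  cont_on P (fun t => half_inv (g t) r (y t)).
Proof.
move=> cy by_ vy.
apply: (@binv_curve R P (fun t => half_lo (g t) r) (fun t => half_hi (g t) r)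
  (fun t => fn (g t)) (half_sign R G r)) => //.
- exact: half_sign_sign.
- apply: jcont_sub (tame_jcont g0) => // t Pt; exact: half_sub (tame_class Pt) r.
- by case: r; [exact: crit_curve|exact: tame_lo g0].
- by case: r; [exact: tame_hi g0|exact: crit_curve].
- by move=> t Pt; apply/ltW/(half_lt (tame_class Pt)).
- by move=> t Pt; apply: (@half_smono _ _ _ (tame_class Pt)).
- by move=> t Pt; apply: (half_range (tame_class Pt)); [exact: by_|exact: vy].
Qed.

Lemma inv_word_curve v z : nonzero_word G v -> cont_on P z ->
  (forall t, P t -> base_lo (g t) <= z t <= base_hi (g t)) ->
  cont_on P (fun t => inv_word (g t) v (z t)).
Proof.
move=> hv cz bz; elim: v hv => [//|k v IH] /= /andP[/andP[hk /eqP k0] hv].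
apply: (@binv_curve R P (fun t => lo (g t) k) (fun t => hi (g t) k)
  (fun t => fn (g t)) (eps R G k)).
- exact: eps_sign.
- exact: tame_jcont.
- exact: tame_lo.
- exact: tame_hi.
- exact: IH.
- by move=> t Pt; apply/ltW/(lo_lt_hi (tame_class Pt)).
- by move=> t Pt; apply: (fn_smono (tame_class Pt)).
- move=> t Pt; apply: (fn_onto (tame_class Pt) hk k0).
  exact: (inv_word_base (tame_class Pt) hv (bz t Pt)).
Qed.

Lemma start_end_curve e : cont_on P (fun t => start_end (g t) e).
Proof. by rewrite /start_end; case: (e == 1); [exact: tame_lo|exact: tame_hi]. Qed.

Section Return.
Variables (G' : spin_semigroup) (chi : seq int -> seq int) (phi : R -> R).
Hypothesis adm : admissible G' G chi.
Hypothesis phi_in : forall t, P t -> lo (g t) 0 < phi t < hi (g t) 0.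
Hypothesis crit_value : forall t, P t ->
  fn (g t) (crit (g t)) = inv_word (g t) (letters chi 0) (phi t).

Lemma half_inv_letters_curve r j e : generator G' j -> (j = 0 -> e = - eps R G' 0) ->
  cont_on P (fun t => half_inv (g t) r (inv_word (g t) (letters chi j) (start_end (g t) e))).
Proof.
move=> hj je; have hv := letters_nonzero adm hj.
have hb t : P t -> base_lo (g t) <= start_end (g t) e <= base_hi (g t).
  by move=> Pt; have T := tame_class Pt; apply: (I0_base T); exact: start_end_I0 T e.
apply: half_inv_curve.
- exact: (inv_word_curve hv (@start_end_curve e) hb).
- by move=> t Pt; exact: (inv_word_base (tame_class Pt) hv (hb t Pt)).
- move=> t Pt; have T := tame_class Pt.
  have [j0|/eqP j0] := eqVneq j 0.
    by rewrite j0 je //; apply/ltW/(crit_lt_tau adm T (phi_in Pt) (crit_value Pt)).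
  apply/ltW/(crit_lt_letters adm T (phi_in Pt) (crit_value Pt) hj j0).
  exact: start_end_I0 T e.
Qed.

Lemma tame_return : tame_family G' P (fun t => return_of G' chi (g t)).
Proof.
have llo j : generator G' j -> cont_on P (fun t => ret_lo G' chi (g t) j).
  by move=> hj; apply: half_inv_letters_curve => // ->; rewrite eqxx.
have lhi j : generator G' j -> cont_on P (fun t => ret_hi G' chi (g t) j).
  by move=> hj; apply: half_inv_letters_curve => // ->.
split.
- move=> t Pt; have T := tame_class Pt.
  have C := ret_class_T adm T (phi_in Pt) (crit_value Pt).
  by have S := ret_spin adm T (phi_in Pt) (crit_value Pt).
- by split; [exact: tame_lo g0|exact: tame_hi g0].
- by move=> j hj; split; [exact: llo|exact: lhi].
move=> j hj.
have it i : (i <= size (letters chi j))%N ->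
    jcont P (fun t => ret_lo G' chi (g t) j) (fun t => ret_hi G' chi (g t) j)
      (fun t => iter i.+1 (fn (g t))).
  elim: i => [|i IH] hi.
    apply: jcont_sub (tame_jcont g0) => // t Pt.
    have [h1 h2] := ret_inner adm (tame_class Pt) (phi_in Pt) (crit_value Pt) hj.
    by split; apply: ltW.
  have hk : generator G (nth 0 (letters chi j) i).
    by have /andP[] := allP (letters_nonzero adm hj) _ (mem_nth 0 hi).
  apply: (jcont_comp (IH (ltnW hi)) _ (tame_jcont hk)) => t x Pt hx.
  by have [_ _] := ret_itinerary adm (tame_class Pt) (phi_in Pt) (crit_value Pt) hj hx hi.
apply: jcont_sub (it _ (leqnn _)) => // t x Pt hx.
by rewrite (ret_fn adm (tame_class Pt) (phi_in Pt) (crit_value Pt) hj hx).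
Qed.

End Return.
End Curves.
End TameFamily.

(** * A value whose two preimages in I_0 enclose all the K_j *)

Section Barrier.
Variables (R : realType) (G : spin_semigroup) (g : interval_map R).
Hypothesis gT : class_T_spin G g.

Let o : R := orient R G.

(** The extreme point of the union of the I_k on the side of [fold_end]. *)
Definition outer (g : interval_map R) : R :=
  if orient R G == 1 then hi g (spos G)%:Z else lo g (- (sneg G)%:Z).

(* A value strictly between the critical value and all the I_k on one side, and
   the end of J to which both ends of I_0 are mapped on the other side. *)
Definition barrier (g : interval_map R) : R :=
  orient R G * ((Num.max (orient R G * fn g (crit g)) (orient R G * outer g)
                 + orient R G * fold_end G g) / 2).

Lemma generator_last : generator G (spos G)%:Z.
Proof. by rewrite /generator /in_range; lia. Qed.

Lemma generator_first : generator G (- (sneg G)%:Z).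
Proof. by rewrite /generator /in_range; lia. Qed.

Lemma outer_max k x : generator G k -> lo g k <= x <= hi g k -> o * x <= o * outer g.
Proof.
move=> hk hx; rewrite /outer /o; have lt := lo_lt_hi gT hk.
have /andP[k1 k2] := hk.
case: (orient_sign R G) => ->; rewrite ?eqxx ?mul1r.
  move: k2; rewrite le_eqVlt => /orP[/eqP <-|k2]; first lra.
  have := hi_lt_lo gT hk generator_last k2; have := lo_lt_hi gT generator_last; lra.
have -> : ((-1 : R) == 1) = false by apply/eqP; lra.
rewrite !mulN1r lerN2.
move: k1; rewrite le_eqVlt => /orP[/eqP ->|k1]; first lra.
have := hi_lt_lo gT generator_first hk k1; have := lo_lt_hi gT generator_first; lra.
Qed.

Lemma fold_end_gt : o * fn g (crit g) < o * fold_end G g /\ o * outer g < o * fold_end G g.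
Proof.
have hc := crit_in gT; split.
  rewrite -(fold_endP gT (or_introl erefl)).
  by have := smono_left gT (lexx _) (_ : lo g 0 < crit g) (lexx _); rewrite !mulNr; lra.
rewrite /outer /fold_end /o; case: (orient_sign R G) => ->; rewrite ?eqxx ?mul1r.
  by have := base_lt gT generator_last; lra.
have -> : ((-1 : R) == 1) = false by apply/eqP; lra.
by have := base_lt gT generator_first; lra.
Qed.

Lemma barrierE : o * barrier g =
  (Num.max (o * fn g (crit g)) (o * outer g) + o * fold_end G g) / 2.
Proof. by rewrite /barrier mulrA (sign_sq (orient_sign R G)) mul1r. Qed.

Lemma barrierP : [/\ o * fn g (crit g) < o * barrier g, o * outer g < o * barrier g &
  o * barrier g < o * fold_end G g].
Proof.
have [h1 h2] := fold_end_gt; rewrite barrierE.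
by case: (leP (o * fn g (crit g)) (o * outer g)) => h3; split; lra.
Qed.

Lemma barrier_base : base_lo g <= barrier g <= base_hi g.
Proof.
have [h1 _ h3] := barrierP; have hb := fold_end_base gT.
have hv : base_lo g <= fn g (crit g) <= base_hi g.
  by apply/(fn_base gT)/(dom_itv gT (generator0 G)); have := crit_in gT; lra.
by move: h1 h3; rewrite /o; case: (orient_sign R G) => ->; lra.
Qed.

Lemma half_barrierP r : half_lo g r <= half_inv g r (barrier g) <= half_hi g r /\
  fn g (half_inv g r (barrier g)) = barrier g.
Proof.
apply: (half_invP gT r barrier_base); have [h _ _] := barrierP; exact: ltW.
Qed.

Lemma left_barrier : lo g 0 < half_inv g false (barrier g) < crit g.
Proof.
have [/= /andP[h1 h2] f] := half_barrierP false; have [b1 _ b3] := barrierP.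
rewrite !lt_neqAle h1 h2 !andbT; apply/andP; split; apply/eqP => E.
  by have := fold_endP gT (or_introl erefl); rewrite E f => E'; rewrite E' ltxx in b3.
by move: f b1; rewrite E => <-; rewrite ltxx.
Qed.

Lemma right_barrier : crit g < half_inv g true (barrier g) < hi g 0.
Proof.
have [/= /andP[h1 h2] f] := half_barrierP true; have [b1 _ b3] := barrierP.
rewrite !lt_neqAle h1 h2 !andbT; apply/andP; split; apply/eqP => E.
  by move: f b1; rewrite -E => <-; rewrite ltxx.
by have := fold_endP gT (or_intror erefl); rewrite -E f => E'; rewrite E' ltxx in b3.
Qed.

Lemma lt_barrier k x : generator G k -> lo g k <= x <= hi g k -> o * x < o * barrier g.
Proof. by move=> hk hx; have := outer_max hk hx; have [_ h _] := barrierP; lra. Qed.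

Lemma inv_word_itv v z : nonzero_word G v -> lo g 0 <= z <= hi g 0 ->
  exists2 k, generator G k & lo g k <= inv_word g v z <= hi g k.
Proof.
case: v => [|k v] /=; first by exists 0 => //; exact: generator0.
move=> /andP[/andP[hk /eqP k0] hv] hz; exists k => //.
by have [] := inv_branchP gT hk k0 (inv_word_base gT hv (I0_base gT hz)).
Qed.

Variables (G' : spin_semigroup) (chi : seq int -> seq int) (phi : R).
Hypothesis adm : admissible G' G chi.
Hypothesis phi_in : lo g 0 < phi < hi g 0.
Hypothesis crit_value : fn g (crit g) = inv_word g (letters chi 0) phi.

(** The image of K_j is contained in a pull-back, hence in the I_k of its first letter, and so stays
    short of the barrier. Points of I_0 outside the two preimages are mapped beyond the barrier. *)
Lemma ret_within_barriers j : generator G' j ->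
  half_inv g false (barrier g) <= ret_lo G' chi g j /\
  ret_hi G' chi g j <= half_inv g true (barrier g).
Proof.
move=> hj; have lt := ret_lt adm gT phi_in crit_value hj.
have [i1 i2] := ret_inner adm gT phi_in crit_value hj.
have small x : ret_lo G' chi g j <= x <= ret_hi G' chi g j -> o * fn g x < o * barrier g.
  move=> /(ret_mem adm gT phi_in crit_value x hj) [_ _ [z hz ->]].
  have [k hk hz'] := inv_word_itv (letters_nonzero adm hj) hz.
  exact: lt_barrier hk hz'.
have [_ fl] := half_barrierP false; have [_ fr] := half_barrierP true.
have hl := left_barrier; have hr := right_barrier.
split; rewrite leNgt; apply/negP => H.
  have := small (ret_lo G' chi g j) ltac:(lra).
  have := smono_left gT (ltW i1) H ltac:(lra).
  by rewrite fl !mulNr ltrN2 -/o; lra.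
have := small (ret_hi G' chi g j) ltac:(lra).
have := smono_right gT _ H (ltW i2).
by rewrite fr -/o => /(_ ltac:(lra)); lra.
Qed.

End Barrier.

(** * Renormalization of full families *)

Section CrossingFamilies.
Variable R : realType.

Definition crit_below (G : spin_semigroup) (g : interval_map R) :=
  forall k, generator G k -> fn g (crit g) <= lo g k.

Definition crit_above (G : spin_semigroup) (g : interval_map R) :=
  forall k, generator G k -> hi g k <= fn g (crit g).

Definition crossing_family (G : spin_semigroup) (a b : R) (g : R -> interval_map R) :=
  tame_family G `[a, b] g /\
  ((crit_below G (g a) /\ crit_above G (g b)) \/
   (crit_above G (g a) /\ crit_below G (g b))).

(* The critical value has to cross the pull-back of I_0 along [chi [:: 0]] as [t]
   varies. [w] measures its position between the pull-backs of the two preimages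
   of the barrier, which enclose all the K_j. *)
Lemma crossing_step (G G' : spin_semigroup) (chi : seq int -> seq int) (a b : R)
    (g : R -> interval_map R) : a <= b -> admissible G' G chi -> crossing_family G a b g ->
  exists a' b', [/\ a <= a', a' <= b', b' <= b,
    crossing_family G' a' b' (fun t => return_of G' chi (g t)) &
    forall t, a' <= t <= b' -> return_map (g t) (return_of G' chi (g t)) /\
      return_type (g t) (return_of G' chi (g t)) G' G chi].
Proof.
move=> ab adm [tame ends].
pose P : set R := `[a, b]%classic.
have inP t : a <= t <= b -> P t by move=> ht; rewrite /P /= in_itv.
have T t : a <= t <= b -> class_T_spin G (g t) by move=> /inP Pt; have := tame_class tame Pt.
have v0 := letters_nonzero adm (generator0 G').
pose e := word_sign R G (letters chi 0).
have se : is_sign e := word_sign_sign R v0.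
pose A r t := half_inv (g t) r (barrier G (g t)).
pose V t := fn (g t) (crit (g t)).
pose I r t := inv_word (g t) (letters chi 0) (A r t).
have A_in r t : a <= t <= b -> lo (g t) 0 < A r t < hi (g t) 0.
  move=> /T Tt; have := left_barrier Tt; have := right_barrier Tt.
  by rewrite /A; case: r; lra.
have A_lt t : a <= t <= b -> A false t < A true t.
  by move=> /T Tt; have := left_barrier Tt; have := right_barrier Tt; rewrite /A; lra.
have A_base r t : a <= t <= b -> base_lo (g t) <= A r t <= base_hi (g t).
  by move=> ht; apply: (I0_base (T t ht)); have := A_in r t ht; lra.
have cA r : cont_on P (A r).
  apply: (half_inv_curve tame) => [|t|t].
  - apply: curveM; first exact: curve_cst.
    apply: curveM; last exact: curve_cst.
    have cV := crit_value_curve tame.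
    apply: curveD.
      apply: curve_max; apply: curveM; try exact: curve_cst; first exact: cV.
      rewrite /outer; case: (orient R G == 1).
        exact: (tame_hi tame (generator_last G)).
      exact: (tame_lo tame (generator_first G)).
    apply: curveM; first exact: curve_cst.
    by rewrite /fold_end; case: tame => _ [h1 h2] _ _; case: (orient R G == 1).
  - by rewrite /P /= in_itv /= => /T; exact: barrier_base.
  - by rewrite /P /= in_itv /= => /T /barrierP [h _ _]; exact: ltW.
have cI r : cont_on P (I r).
  apply: (inv_word_curve tame v0 (cA r)) => t.
  by rewrite /P /= in_itv /=; exact: A_base.
have cV : cont_on P V := crit_value_curve tame.
have I_lt t : a <= t <= b -> e * I false t < e * I true t.
  move=> ht; apply: (inv_word_smono (T t ht) v0 _ (A_lt t ht)).
    by have := A_base false t ht; lra.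
  by have := A_base true t ht; lra.
have D0 t : a <= t <= b -> I true t - I false t != 0.
  move=> ht; rewrite subr_eq0; apply/eqP => E.
  by have := I_lt t ht; rewrite E ltxx.
pose w t := (V t - I false t) / (I true t - I false t).
have cw : cont_on P w.
  apply: curveM; first by apply: curveD => //; exact: curveN.
  apply: curveV; first by apply: curveD => //; exact: curveN.
  by move=> t; rewrite /P /= in_itv /=; exact: D0.
(* Both points to be crossed belong to some I_k, so a critical value beyond all the I_k is beyond
   both of them. This is how the conditions at [a] and [b] are used. *)
have I_itv r t : a <= t <= b -> exists2 k, generator G k & lo (g t) k <= I r t <= hi (g t) k.
  move=> ht; apply: (inv_word_itv (T t ht) v0).
  by have := A_in r t ht; lra.
have below_I t : a <= t <= b -> crit_below G (g t) -> V t <= I false t /\ V t <= I true t.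
  move=> ht H; have [k hk h1] := I_itv false t ht; have [l hl h2] := I_itv true t ht.
  by have := H k hk; have := H l hl; rewrite /V; lra.
have above_I t : a <= t <= b -> crit_above G (g t) -> I false t <= V t /\ I true t <= V t.
  move=> ht H; have [k hk h1] := I_itv false t ht; have [l hl h2] := I_itv true t ht.
  by have := H k hk; have := H l hl; rewrite /V; lra.
(* The denominator of [w] has the sign [e], so [w] runs from 0 at [I false] to 1 at [I true] in
   either orientation. *)
have w_le0 t : a <= t <= b -> e * V t <= e * I false t -> w t <= 0.
  move=> ht; have := I_lt t ht; rewrite /w; case: se => -> h1 h2.
    by rewrite ler_pdivrMr; lra.
  by rewrite ler_ndivrMr; lra.
have w_ge1 t : a <= t <= b -> e * I true t <= e * V t -> 1 <= w t.
  move=> ht; have := I_lt t ht; rewrite /w; case: se => -> h1 h2.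
    by rewrite ler_pdivlMr; lra.
  by rewrite ler_ndivlMr; lra.
have haa : a <= a <= b by rewrite lexx.
have hbb : a <= b <= b by rewrite ab lexx.
have w_ends : (w a <= 0 /\ 1 <= w b) \/ (1 <= w a /\ w b <= 0).
  move: (w_le0 a haa) (w_ge1 a haa) (w_le0 b hbb) (w_ge1 b hbb).
  case: ends => -[].
    move=> /(below_I a haa) [h1 h2] /(above_I b hbb) [h3 h4] w1 w2 w3 w4.
    case: se => E; rewrite E in w1 w2 w3 w4; [left|right]; split.
    - by apply: w1; lra.
    - by apply: w4; lra.
    - by apply: w2; lra.
    - by apply: w3; lra.
  move=> /(above_I a haa) [h1 h2] /(below_I b hbb) [h3 h4] w1 w2 w3 w4.
  case: se => E; rewrite E in w1 w2 w3 w4; [right|left]; split.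
  - by apply: w2; lra.
  - by apply: w3; lra.
  - by apply: w1; lra.
  - by apply: w4; lra.
have [a' [b' [aa' ab' bb' w01 wends]]] := crossing ab cw w_ends.
have sub t : a' <= t <= b' -> a <= t <= b by lra.
have VE t : a <= t <= b -> V t = I false t + w t * (I true t - I false t).
  by move=> ht; rewrite /w mulfVK ?D0 // addrC subrK.
(* [phi] is chosen separately at each parameter, with value 0 outside the subinterval; its position
   between the two barrier preimages makes it interior to I_0. *)
have /choice [phi phiP] : forall t, exists z, a' <= t <= b' ->
    lo (g t) 0 < z < hi (g t) 0 /\ fn (g t) (crit (g t)) = inv_word (g t) (letters chi 0) z.
  move=> t; have [ht|ht] := boolP (a' <= t <= b'); last by exists 0 => H; case/negP: ht.
  have hab := sub t ht; have := w01 t ht => hw.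
  have btw : I false t <= V t <= I true t \/ I true t <= V t <= I false t.
    have := I_lt t hab; have := VE t hab; case: se => -> E h; [left|right]; rewrite E; nra.
  have [||z hz E] := inv_word_between (T t hab) v0 (ltW (A_lt t hab)) _ _ btw.
  - by have := A_base false t hab; lra.
  - by have := A_base true t hab; lra.
  exists z => _; split => //.
  by have := A_in false t hab; have := A_in true t hab; lra.
have inP' t : `[a', b']%classic t -> a' <= t <= b' by rewrite /= in_itv.
have phi_in t (ht : `[a', b']%classic t) := (phiP t (inP' t ht)).1.
have crit_value t (ht : `[a', b']%classic t) := (phiP t (inP' t ht)).2.
exists a', b'; split => //; last first.
  move=> t ht; have Tt := T t (sub t ht); have [h1 h2] := phiP t ht.
  have rm := ret_return_map adm Tt h1 h2.
  by have rt := ret_return_type adm Tt h1 h2.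
have tame' : tame_family G `[a', b'] g.
  by apply: tame_family_sub tame => t /inP' /sub /inP.
split; first exact: (tame_return tame' adm phi_in crit_value).
(* At [w t = 0] the critical value is the pull-back of [A false t], so the return map has critical
   value [A false t], to the left of all the K_j. At [w t = 1] it is likewise [A true t], to their
   right. *)
have end0 t : a' <= t <= b' -> w t = 0 -> crit_below G' (return_of G' chi (g t)).
  move=> ht w0 k hk; have hab := sub t ht; have := VE t hab.
  rewrite w0 mul0r addr0 => E.
  have := ret_crit adm (T t hab) (A_in false t hab) E => /= ->.
  by have [] := ret_within_barriers (T t hab) adm (A_in false t hab) E hk.
have end1 t : a' <= t <= b' -> w t = 1 -> crit_above G' (return_of G' chi (g t)).
  move=> ht w1 k hk; have hab := sub t ht; have := VE t hab.
  rewrite w1 mul1r addrC subrK => E.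
  have := ret_crit adm (T t hab) (A_in true t hab) E => /= ->.
  by have [] := ret_within_barriers (T t hab) adm (A_in true t hab) E hk.
have ha' : a' <= a' <= b' by rewrite lexx.
have hb' : a' <= b' <= b' by rewrite ab' lexx.
case: wends => -[h1 h2]; [left|right].
  by split; [exact: end0|exact: end1].
by split; [exact: end1|exact: end0].
Qed.

(** A point of I_k(r) is compared with the point of I_k(t) having the same affine coordinate:
    uniform convergence handles the change of branch, and continuity of [fn (g t)] the change of
    point, each with half of [e]. *)
Lemma branch_jcont (G : spin_semigroup) (t0 t1 : R) (g : R -> interval_map R) (k : int) :
  continuous_family G t0 t1 g -> generator G k ->
  jcont `[t0, t1] (fun t => lo (g t) k) (fun t => hi (g t) k) (fun t => fn (g t)).
Proof.
move=> [gT _ lh br] hk t Pt x hx e e0.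
have [/cont_onP cl /cont_onP ch] := lh k hk.
have ht : t0 <= t <= t1 by move: Pt; rewrite /= in_itv.
have T := gT t ht; have lt := lo_lt_hi T hk.
have e2 : 0 < e / 2 by lra.
have hx' : [set` `[lo (g t) k, hi (g t) k]] x by rewrite /= in_itv.
have [d d0 Hd] := near_dist_ex (fn_cont T hk hx' e2).
(* [y] is within [d / 4] of [x], and moving the ends of I_k by less than [d / 8] moves a point of
   given affine coordinate by less than [d / 8]; the sum is below [d]. *)
exists (d / 4); first lra.
have d8 : 0 < d / 8 by lra.
have unif : \forall r \near t, `[t0, t1]%classic r -> forall u, 0 <= u <= 1 ->
    `|branch (g r) k u - branch (g t) k u| < e / 2.
  have := br k t hk ht.
  move=> /(_ [set f | forall u, 0 <= u <= 1 -> `|f u - branch (g t) k u| < e / 2]).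
  have nb : @nbhs _ {uniform` `[0, 1]%classic -> R} (branch (g t) k)
      [set f | forall u, 0 <= u <= 1 -> `|f u - branch (g t) k u| < e / 2].
    apply/uniform_nbhs; exists [set xy : R * R | ball xy.1 (e / 2) xy.2]; split.
      by rewrite -entourage_ballE; exists (e / 2).
    move=> f H u hu; have := H u; rewrite /= in_itv /= => /(_ hu).
    by rewrite -ball_normE /= distrC.
  by move=> /(_ nb) H; exact: H.
apply: filterS2 unif (filterI (cl t Pt _ d8) (ch t Pt _ d8)) => r H1 [H2 H3] Pr y hy yx.
have hr : t0 <= r <= t1 by move: Pr; rewrite /= in_itv.
have ltr := lo_lt_hi (gT r hr) hk.
pose u := (y - lo (g r) k) / (hi (g r) k - lo (g r) k).
have D0 : hi (g r) k - lo (g r) k != 0 by apply/eqP; lra.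
have hu : 0 <= u <= 1.
  by apply/andP; split; [rewrite divr_ge0; lra|rewrite ler_pdivrMr; lra].
have uE : u * (hi (g r) k - lo (g r) k) = y - lo (g r) k by rewrite /u mulfVK.
have by_ : branch (g r) k u = fn (g r) y.
  by rewrite /branch /line_path; congr (fn _ _); lra.
pose y' := line_path (lo (g t) k) (hi (g t) k) u.
have y'E : y' = lo (g t) k + u * (hi (g t) k - lo (g t) k).
  by rewrite /y' /line_path; ring.
have hy' : [set` `[lo (g t) k, hi (g t) k]] y' by rewrite /= in_itv /= y'E; nra.
have close : `|y' - x| < d.
  have h2 := H2 Pr; have h3 := H3 Pr; move: h2 h3 yx.
  rewrite y'E !ltr_distl; nra.
have := Hd y' close hy'; have := H1 Pr u hu.
rewrite by_ -[branch (g t) k u]/(fn (g t) y') !ltr_distl; lra.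
Qed.

(** The image of I_0 lies entirely on one side of the critical value, so whatever it covers lies on
    that side. *)
Lemma covers_all_crit (G : spin_semigroup) (g : interval_map R) : class_T_spin G g ->
  covers_all g -> if orient R G == 1 then crit_below G g else crit_above G g.
Proof.
move=> T cov.
have ext k x : generator G k -> lo g k <= x <= hi g k ->
    orient R G * fn g (crit g) <= orient R G * x.
  move=> hk hx; have [||y /itvP hy <-] := cov k _ x.
  - by rewrite (index_generator T).
  - exact/itvP.
  exact: (crit_extremum T).
case: (orient_sign R G) => E; rewrite E in ext *.
  rewrite eqxx => k hk; have := ext k (lo g k) hk; have := lo_lt_hi T hk; lra.
have -> : ((-1 : R) == 1) = false by apply/eqP; lra.
move=> k hk; have := ext k (hi g k) hk; have := lo_lt_hi T hk; lra.
Qed.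

(** The image of I_0 contains every value from the critical value to [fold_end]. An I_k not yet
    passed by the critical value would have interior points there; the midpoints below are such
    points. *)
Lemma misses_all_crit (G : spin_semigroup) (g : interval_map R) : class_T_spin G g ->
  misses_all g -> if orient R G == 1 then crit_above G g else crit_below G g.
Proof.
move=> T mis.
have out k x : generator G k -> lo g k < x < hi g k ->
    orient R G * fn g (crit g) <= orient R G * x -> False.
  move=> hk hx hv; have hb := base_lt T hk.
  have [] := half_invP T true (_ : base_lo g <= x <= base_hi g) hv; first lra.
  move=> /= hi1 f; have hc := crit_in T.
  have := mis k; rewrite (index_generator T) => /(_ hk); rewrite -subset0 => /(_ x); apply.
  split; last by rewrite /itv_interior /= in_itv.
  by exists (half_inv g true x) => //; apply/itvP; lra.
case: (orient_sign R G) => E; rewrite E in out *.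
  rewrite eqxx => k hk; rewrite leNgt; apply/negP => H.
  have lt := lo_lt_hi T hk.
  have [h|h] := leP (fn g (crit g)) (lo g k).
    by apply: (out k ((lo g k + hi g k) / 2) hk); lra.
  by apply: (out k ((fn g (crit g) + hi g k) / 2) hk); lra.
have -> : ((-1 : R) == 1) = false by apply/eqP; lra.
move=> k hk; rewrite leNgt; apply/negP => H.
have lt := lo_lt_hi T hk.
have [h|h] := leP (hi g k) (fn g (crit g)).
  by apply: (out k ((lo g k + hi g k) / 2) hk); lra.
by apply: (out k ((lo g k + fn g (crit g)) / 2) hk); lra.
Qed.

Lemma full_crossing (G : spin_semigroup) (t0 t1 : R) (g : R -> interval_map R) :
  t0 <= t1 -> full_family G t0 t1 g -> crossing_family G t0 t1 g.
Proof.
move=> t01 [cf ends]; have [gT [bl bh] lh _] := cf.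
split.
  split.
  - by move=> t; rewrite /= in_itv; exact: gT.
  - by split; apply/cont_onP.
  - by move=> k /lh[h1 h2]; split; apply/cont_onP.
  - by move=> k hk; exact: branch_jcont cf hk.
have T0 := gT t0 ltac:(rewrite lexx t01 //); have T1 := gT t1 ltac:(rewrite lexx t01 //).
case: ends => -[h0 h1].
  have := covers_all_crit T0 h0; have := misses_all_crit T1 h1.
  by case: ifP => _ ? ?; [left|right].
have := covers_all_crit T1 h1; have := misses_all_crit T0 h0.
by case: ifP => _ ? ?; [right|left].
Qed.

End CrossingFamilies.

Lemma nested_intervals (R : realType) (a b : nat -> R) :
  (forall n, [/\ a n <= a n.+1, a n <= b n & b n.+1 <= b n]) ->
  exists t, forall n, a n <= t <= b n.
Proof.
move=> H.
have am n m : (n <= m)%N -> a n <= a m.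
  move=> nm; rewrite -(subnK nm); elim: (m - n)%N => [|k IH]; first by rewrite add0n.
  by rewrite addSn; apply: le_trans IH _; have [] := H (k + n)%N.
have bm n m : (n <= m)%N -> b m <= b n.
  move=> nm; rewrite -(subnK nm); elim: (m - n)%N => [|k IH]; first by rewrite add0n.
  by rewrite addSn; apply: le_trans _ IH; have [] := H (k + n)%N.
have amb n m : a n <= b m.
  have [_ h _] := H (maxn n m).
  apply: le_trans (am _ _ (leq_maxl n m)) (le_trans h (bm _ _ (leq_maxr n m))).
have hs : has_sup (range a).
  by split; [exists (a 0%N), 0%N|exists (b 0%N) => _ [n _ <-]; exact: amb].
exists (sup (range a)) => n; apply/andP; split.
  by apply: ub_le_sup; [exact: hs.2|exists n].
by apply: ge_sup; [exact: hs.1|move=> _ [m _ <-]; exact: amb].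
Qed.

Theorem lemma2p7 (R : realType) (G : nat -> spin_semigroup)
    (g : R -> interval_map R) (chi : nat -> seq int -> seq int)
    (hg : full_family (G 0%N) 0 1 g)
    (hchi : forall n : nat, admissible (G n.+1) (G n) (chi n.+1)) :
  exists2 t : R, 0 <= t <= 1 &
  exists h : nat -> interval_map R,
    [/\ h 0%N = g t,
        forall n : nat, class_T (h n) &
        forall n : nat,
          return_map (h n) (h n.+1) /\
          return_type (h n) (h n.+1) (G n.+1) (G n) (chi n.+1)].
Proof.
pose h := fix h n t := if n is n'.+1 then return_of (G n) (chi n) (h n' t) else g t.
(* The next parameter interval is made a total function of the index and the current interval, with
   default [(0, 0)] when the premises fail, so that the recursion can be defined before its
   invariant is proved. *)
have /choice [next nextP] : forall nab : nat * (R * R), exists ab' : R * R,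
    nab.2.1 <= nab.2.2 -> crossing_family (G nab.1) nab.2.1 nab.2.2 (h nab.1) ->
    [/\ nab.2.1 <= ab'.1, ab'.1 <= ab'.2, ab'.2 <= nab.2.2,
      crossing_family (G nab.1.+1) ab'.1 ab'.2 (h nab.1.+1) &
      forall t, ab'.1 <= t <= ab'.2 -> return_map (h nab.1 t) (h nab.1.+1 t) /\
        return_type (h nab.1 t) (h nab.1.+1 t) (G nab.1.+1) (G nab.1) (chi nab.1.+1)].
  move=> [n [a b]] /=.
  have [[ab cr]|no] := pselect (a <= b /\ crossing_family (G n) a b (h n)); last first.
    by exists (0, 0) => ab cr; case: no.
  by have [a' [b' H]] := crossing_step ab (hchi n) cr; exists (a', b').
pose ab := fix ab n := if n is n'.+1 then next (n', ab n') else (0, 1).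
have inv n : (ab n).1 <= (ab n).2 /\ crossing_family (G n) (ab n).1 (ab n).2 (h n).
  elim: n => [|n [le cr]]; first by split; [exact: ler01|exact: full_crossing ler01 hg].
  by have [] := nextP (n, ab n) le cr.
have step n := nextP (n, ab n) (inv n).1 (inv n).2.
have [t ht] : exists t, forall n, (ab n).1 <= t <= (ab n).2.
  apply: (@nested_intervals R (fun n => (ab n).1) (fun n => (ab n).2)) => n.
  by have [h1 h2 h3 _ _] := step n; have [le _] := inv n.
exists t; first exact: (ht 0%N).
exists (fun n => h n t); split => // n.
  have [_ [tame _]] := inv n.
  have Pt : `[(ab n).1, (ab n).2]%classic t by rewrite /= in_itv /= ht.
  by have [] := tame_class tame Pt.
(* The return from level [n] is controlled on the interval of index [n + 1], hence the shifted
   membership of [t]. *)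
by have [_ _ _ _ H] := step n; apply: H; exact: (ht n.+1).
Qed.
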